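(* Consider the two-player system $$x(t+1)=Ax(t)+Bu(t)+v(t),\qquad y(t)=Cx(t)+w(t),\qquad t=0,\dots,N-1,$$ where $u_1(t)$ must be a function of $\mathcal F_1(t)=\{y_1(0:t),u_1(0:t-1),y_2(0:t),u_2(0:t-1)\}$ and $u_2(t)$ a function of $\mathcal F_2(t)=\{y_1(0:t-1),u_1(0:t-1),y_2(0:t),u_2(0:t-1)\}$, and the common objective is to minimize $\mathbb E[\sum_{t=0}^{N-1}(x(t)'Qx(t)+u(t)'Ru(t))+x(N)'Sx(N)]$. Then the optimal control law is $$\begin{bmatrix} u_1^*(t) \\ u_2^*(t)\end{bmatrix}=F^*(t)\begin{bmatrix} y_1(t) \\ y_2(t)\end{bmatrix}+G^*(t)\hat x(t),$$ where $F^*(t)=\begin{bmatrix} F^*_{11}(t)&F^*_{12}(t) \\ \mathbf 0&F^*_{22}(t)\end{bmatrix}$ is the optimal gain, $G^*(t)=-(F^*(t)C+H^*(t))$, and $H^*(t)$ is the gain of the classical linear quadratic regulator for the dynamics $(A,B)$ and cost $(Q,R,S)$.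
   Context: Prime denotes transpose; $z(0:t)=(z(0),\dots,z(t))$. $x$ is the state, $u=(u_1,u_2)$ the inputs of the two players, $y=(y_1,y_2)$ their observations; $A,B,C$ are arbitrary matrices of compatible sizes (no sparsity restriction). $Q,R,S$ are positive definite. $v(t),w(t)$ are zero-mean Gaussian with covariances $V,W$, independent across time, independent of each other and of $x(0)$; $x(0)$ is zero-mean Gaussian with known covariance. Admissible laws are $u_i(t)=f_i(\mathcal F_i(t),t)$. $\mathcal H(t)=\{y(0:t-1),u(0:t-1)\}$ is the common information and $\hat x(t)=\mathbb E[x(t)\mid\mathcal H(t)]$. The problem has a linear optimal law, which can be written $u(t)=\begin{bmatrix} F^*_{11}(t)&F^*_{12}(t) \\ 0&F^*_{22}(t)\end{bmatrix}y(t)+\begin{bmatrix} L_1(\mathcal H(t)) \\ L_2(\mathcal H(t))\end{bmatrix}$ with $L_1,L_2$ linear (possibly time-varying); this defines the optimal gain $F^*(t)$. The classical LQR gain, with sign convention $u=-H^*(t)x$, is $H^*(t)=(B'P(t+1)B+R)^{-1}B'P(t+1)A$, where $P(N)=S$ and $P(t)=Q+A'P(t+1)A-A'P(t+1)BH^*(t)$. *)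

(* Defs.v *)
From HB Require Import structures.
From mathcomp Require Export all_boot all_order all_algebra.
From mathcomp Require Export all_classical all_reals all_analysis.

Set Implicit Arguments.
Unset Strict Implicit.
Unset Printing Implicit Defensive.

Import Order.TTheory GRing.Theory Num.Theory.
Import numFieldNormedType.Exports.

Local Open Scope classical_set_scope.
Local Open Scope ring_scope.

(* The Borel sigma-algebra of a space of real matrices (product topology),
   generated by the entries; it also serves for column vectors. *)

Section MatrixBorel.
Variables (R : realType) (m n : nat).

Definition mx_entries : set (set 'M[R]_(m, n)) :=
  \bigcup_(ij in [set: 'I_m * 'I_n])
     preimage_set_system setT (fun M : 'M[R]_(m, n) => M ij.1 ij.2) measurable.

Definition mx_measurable : set (set 'M[R]_(m, n)) := <<s mx_entries >>.

Lemma mx_measurable0 : mx_measurable set0.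
Proof. exact: sigma_algebra0. Qed.

Lemma mx_measurableC A : mx_measurable A -> mx_measurable (~` A).
Proof. exact: sigma_algebraC. Qed.

Lemma mx_measurable_bigcup (F : (set 'M[R]_(m, n))^nat) :
  (forall i, mx_measurable (F i)) -> mx_measurable (\bigcup_i F i).
Proof. exact: sigma_algebra_bigcup. Qed.

End MatrixBorel.

Fact mx_display : measure_display. Proof. exact: default_measure_display. Qed.

HB.instance Definition _ (R : realType) (m n : nat) :=
  @isMeasurable.Build mx_display 'M[R]_(m, n) (@mx_measurable R m n)
    (@mx_measurable0 R m n) (@mx_measurableC R m n)
    (@mx_measurable_bigcup R m n).

Section Probability.
Variables (R : realType) (d : measure_display) (T : measurableType d).
Variable P : probability T R.

(* [normal_prob m 0] is not the point mass at [m] in the library, so the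
   degenerate case is listed separately; it occurs for singular covariances. *)
Definition gaussian_rv (X : T -> R) : Prop :=
  (exists m, {ae P, forall w, X w = m}) \/
  (exists m s, 0 < s /\
     forall B, measurable B -> P (X @^-1` B) = normal_prob m s B).

Definition gaussian_vec k (X : T -> 'cV[R]_k) : Prop :=
  measurable_fun setT X /\
  forall a : 'cV[R]_k, gaussian_rv (fun w => (a^T *m X w) 0 0).

Definition centered_gaussian k (X : T -> 'cV[R]_k) (V : 'M[R]_k) : Prop :=
  [/\ gaussian_vec X,
      forall i, ('E_P[(fun w => X w i 0)%R] = 0)%E &
      forall i j, covariance P (fun w => X w i 0) (fun w => X w j 0)
                  = (V i j)%:E].

Definition sigma_of d' (U : measurableType d') (X : T -> U) : set (set T) :=
  preimage_set_system setT X measurable.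

Definition mutually_independent (I : finType) (G : I -> set (set T)) : Prop :=
  forall (J : {set I}) (E : I -> set T),
    (forall i, i \in J -> G i (E i)) ->
    P (\bigcap_(i in [set` J]) E i) = (\prod_(i in J) P (E i))%E.

Definition independent_noises n p N (x0 : T -> 'cV[R]_n)
    (v : nat -> T -> 'cV[R]_n) (w : nat -> T -> 'cV[R]_p) : Prop :=
  @mutually_independent (option ('I_N + 'I_N)) (fun i => match i with
    | None => sigma_of x0
    | Some (inl t) => sigma_of (v t)
    | Some (inr t) => sigma_of (w t)
    end).

(* [Y] is a version of the conditional expectation of [X] given the
   sub-sigma-algebra [G]. *)
Definition is_cond_exp (G : set (set T)) (X Y : T -> R) : Prop :=
  [/\ P.-integrable setT (EFin \o X),
      P.-integrable setT (EFin \o Y),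
      forall B, measurable B -> G (Y @^-1` B) &
      forall E, G E ->
        (\int[P]_(w in E) (X w)%:E = \int[P]_(w in E) (Y w)%:E)%E].

Definition is_cond_exp_vec (G : set (set T)) k (X Y : T -> 'cV[R]_k) : Prop :=
  forall i, is_cond_exp G (fun w => X w i 0) (fun w => Y w i 0).

End Probability.

Definition qform (R : realType) k (M : 'M[R]_k) (x : 'cV[R]_k) : R :=
  (x^T *m M *m x) 0 0.

Definition posdefmx (R : realType) k (M : 'M[R]_k) : Prop :=
  M^T = M /\ forall x : 'cV[R]_k, x != 0 -> 0 < qform M x.

Section LQR.
Variables (R : realType) (n m : nat).
Variables (A : 'M[R]_n) (B : 'M[R]_(n, m)).
Variables (Q : 'M[R]_n) (Ru : 'M[R]_m) (S : 'M[R]_n).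

Definition gain_of (P : 'M[R]_n) : 'M[R]_(m, n) :=
  invmx (B^T *m P *m B + Ru) *m (B^T *m P *m A).

Fixpoint cost_to_go (k : nat) : 'M[R]_n :=
  if k is k'.+1 then
    let P := cost_to_go k' in
    Q + A^T *m P *m A - A^T *m P *m B *m gain_of P
  else S.

(* [cost_to_go] counts the steps left: [P(t) = cost_to_go (N - t)], t <= N. *)
Definition lqr_gain (N t : nat) : 'M[R]_(m, n) :=
  gain_of (cost_to_go (N - t.+1)).

End LQR.

(* The common information [(y(0:t-1), u(0:t-1))]; column [s] of each matrix is
   the vector at time [s]. *)
Notation history R p m t := ('M[R]_(p, t) * 'M[R]_(m, t))%type.

Definition rcons_mx (R : realType) k t (M : 'M[R]_(k, t)) (c : 'cV[R]_k)
    : 'M[R]_(k, t.+1) :=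
  \matrix_(i, j) if unlift ord_max j is Some s then M i s else c i 0.

(* The information [F_1(t)] is the common history with all of [y(t)]; [F_2(t)]
   is the common history with the second block of [y(t)] only. *)
Record law (R : realType) (m1 m2 p1 p2 : nat) := Law {
  law1 : forall t, history R (p1 + p2) (m1 + m2) t * 'cV[R]_(p1 + p2) ->
                   'cV[R]_m1;
  law2 : forall t, history R (p1 + p2) (m1 + m2) t * 'cV[R]_p2 -> 'cV[R]_m2
}.

Section System.
Variables (R : realType) (d : measure_display) (T : measurableType d).
Variable P : probability T R.
Variables (n m1 m2 p1 p2 N : nat).
Variables (A : 'M[R]_n) (B : 'M[R]_(n, m1 + m2)) (C : 'M[R]_(p1 + p2, n)).
Variables (x0 : T -> 'cV[R]_n) (v : nat -> T -> 'cV[R]_n).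
Variable w : nat -> T -> 'cV[R]_(p1 + p2).

Local Notation m := (m1 + m2)%N.
Local Notation p := (p1 + p2)%N.
Local Notation law := (law R m1 m2 p1 p2).

Definition apply_law (g : law) t (h : history R p m t) (y : 'cV[R]_p)
    : 'cV[R]_m :=
  col_mx (law1 g (h, y)) (law2 g (h, dsubmx y)).

Fixpoint closed_loop (g : law) (t : nat) (o : T)
    : 'cV[R]_n * history R p m t :=
  match t with
  | 0%N => (x0 o, (0, 0))
  | t'.+1 =>
      let: (x, h) := closed_loop g t' o in
      let y := C *m x + w t' o in
      let u := apply_law g h y in
      (A *m x + B *m u + v t' o, (rcons_mx h.1 y, rcons_mx h.2 u))
  end.

Definition state (g : law) (t : nat) (o : T) : 'cV[R]_n :=
  (closed_loop g t o).1.

Definition past (g : law) (t : nat) (o : T) : history R p m t :=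
  (closed_loop g t o).2.

Definition output (g : law) (t : nat) (o : T) : 'cV[R]_p :=
  C *m state g t o + w t o.

Definition input (g : law) (t : nat) (o : T) : 'cV[R]_m :=
  apply_law g (past g t o) (output g t o).

Definition admissible (g : law) : Prop :=
  forall t, (t < N)%N ->
    measurable_fun setT (law1 g (t := t)) /\
    measurable_fun setT (law2 g (t := t)).

Variables (Q : 'M[R]_n) (Ru : 'M[R]_m) (S : 'M[R]_n).

Definition cost (g : law) : \bar R :=
  ('E_P[(fun o =>
      \sum_(t < N) (qform Q (state g t o) + qform Ru (input g t o))
      + qform S (state g N o))%R])%E.

Definition optimal (g : law) : Prop :=
  admissible g /\ forall g', admissible g' -> (cost g <= cost g')%E.

End System.

Definition linear_law (R : realType) (m1 m2 p1 p2 : nat)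
    (F11 : nat -> 'M[R]_(m1, p1)) (F12 : nat -> 'M[R]_(m1, p2))
    (F22 : nat -> 'M[R]_(m2, p2))
    (L1 : forall t, {linear history R (p1 + p2) (m1 + m2) t -> 'cV[R]_m1})
    (L2 : forall t, {linear history R (p1 + p2) (m1 + m2) t -> 'cV[R]_m2})
    : law R m1 m2 p1 p2 :=
  Law (fun t hy => F11 t *m usubmx hy.2 + F12 t *m dsubmx hy.2 + L1 t hy.1)
      (fun t hy => F22 t *m hy.2 + L2 t hy.1).

(* Main.v *)
(* Subtracting the effect of the past inputs turns every law into a measurable
   function of the outputs of the uncontrolled system, with the same information
   pattern. The admissible input processes thus form a linear space on which the
   cost is a strictly convex quadratic functional: optimal inputs are almost
   surely unique, and the first variation vanishes at an optimum.

   Perturb an optimum at time t by a constant vector on an event E of H(t), and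
   afterwards feed the state perturbation back through the regulator gain K. Since
   the noises v(s), s >= t, have mean 0 on E, the vanishing of the first variation
   reduces to a deterministic computation with the Riccati recursion, which gives
   E[u(t); E] = - K(t) E[x(t); E]. As w(t) also has mean 0 on E, an input of the
   form F y(t) + L, with L a function of H(t), must have L = - (F C + K) xhat(t).
   Conversely, a law of the announced form has the inputs of the given linear
   optimum, by induction on time. *)

From HB Require Import structures.
Require Import Defs.
From mathcomp Require Import all_boot all_order all_algebra.
From mathcomp Require Import all_classical all_reals all_analysis.
From mathcomp Require Import measurable_realfun lra ring zify.

Set Implicit Arguments.
Unset Strict Implicit.
Unset Printing Implicit Defensive.

Import Order.TTheory GRing.Theory Num.Theory.
Import numFieldNormedType.Exports.

Local Open Scope classical_set_scope.
Local Open Scope ring_scope.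

(** * Quadratic forms and the regulator recursion *)

(** The information constraint does not bite along the perturbations that are used: an event of the
    common past is known to both players, so both inputs may be shifted on it together, and the
    state responds by an indicator times a deterministic trajectory. Hence the centralised gain
    appears although the gain on [y(t)] is sparse. The obstacle is that the common past depends on
    the law. In the converse, two laws have pasts that agree almost surely but generate different
    sigma-algebras; a conditional expectation is therefore written as a measurable function of the
    past, and that same function is evaluated on the past of the other law. In the direct part, the
    gain F comes from one given linear optimum, while an optimal law need not be linear; almost sure
    uniqueness carries the form from one to the other. *)

Lemma addmxE (R : realType) m n (X Y : 'M[R]_(m, n)) i j :
  (X + Y) i j = X i j + Y i j.
Proof. by rewrite mxE. Qed.

Lemma oppmxE (R : realType) m n (X : 'M[R]_(m, n)) i j : (- X) i j = - X i j.
Proof. by rewrite mxE. Qed.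

(** The polar form of [qform]: [qform M x] and [bform M x x] are convertible, and later proofs pass
    silently between them. *)
Definition bform (R : realType) k (M : 'M[R]_k) (x y : 'cV[R]_k) : R :=
  (x^T *m M *m y) 0 0.

Section BilinearForm.
Variables (R : realType) (k : nat) (M : 'M[R]_k).
Implicit Types x y z : 'cV[R]_k.

Lemma bform_Dl x y z : bform M (x + y) z = bform M x z + bform M y z.
Proof. by rewrite /bform linearD /= !mulmxDl mxE. Qed.

Lemma bform_Dr x y z : bform M x (y + z) = bform M x y + bform M x z.
Proof. by rewrite /bform mulmxDr mxE. Qed.

Lemma bform_Zl a x y : bform M (a *: x) y = a * bform M x y.
Proof. by rewrite /bform linearZ /= -!scalemxAl mxE. Qed.

Lemma bform_Zr a x y : bform M x (a *: y) = a * bform M x y.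
Proof. by rewrite /bform -scalemxAr mxE. Qed.

Lemma bform0r x : bform M x 0 = 0.
Proof. by rewrite /bform mulmx0 mxE. Qed.

Lemma bform0l x : bform M 0 x = 0.
Proof. by rewrite /bform trmx0 !mul0mx mxE. Qed.

Lemma bform_sym x y : M^T = M -> bform M x y = bform M y x.
Proof.
move=> MT; rewrite /bform.
have -> : x^T *m M *m y = (y^T *m M *m x)^T.
  by rewrite !trmx_mul trmxK MT mulmxA.
by rewrite mxE.
Qed.

Lemma bform_entries x y :
  bform M x y = \sum_i \sum_j M i j * (x i 0 * y j 0).
Proof.
rewrite /bform mxE exchange_big; apply: eq_bigr => j _ /=.
rewrite mxE mulr_suml; apply: eq_bigr => i _.
by rewrite mxE [x i 0 * M i j]mulrC mulrA.
Qed.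

Lemma posdef_qform_ge0 x : posdefmx M -> 0 <= qform M x.
Proof.
case=> _ Mpos; have [->|/Mpos/ltW//] := eqVneq x 0.
by rewrite /qform mulmx0 mxE.
Qed.

Lemma posdef_qform_eq0 x : posdefmx M -> qform M x = 0 -> x = 0.
Proof.
case=> _ Mpos qx; apply/eqP; apply: contraT => /Mpos.
by rewrite qx ltxx.
Qed.

Lemma posdef_unitmx : posdefmx M -> M \in unitmx.
Proof.
move=> [_ Mpos]; apply: contraT; rewrite -row_free_unit -kermx_eq0.
case/rowV0Pn => r /sub_kermxP rM r0.
have /Mpos : r^T != 0 by apply: contra_neq r0 => /(congr1 trmx); rewrite trmxK trmx0.
by rewrite /qform trmxK rM mul0mx mxE ltxx.
Qed.

(* Cauchy-Schwarz for the inner product of M, against the vector M^-1 e_i. *)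
Lemma sqr_entry_le_qform : posdefmx M ->
  exists2 c : 'I_k -> R, (forall i, 0 <= c i) &
    forall i x, x i 0 ^+ 2 <= c i * qform M x.
Proof.
move=> Mpos; have Mu := posdef_unitmx Mpos; have [MT _] := Mpos.
pose a i : 'cV[R]_k := invmx M *m delta_mx i 0.
exists (fun i => qform M (a i)) => [i|i x]; first exact: posdef_qform_ge0.
have aMx y : bform M (a i) y = y i 0.
  rewrite /bform /a trmx_mul trmx_inv MT -!mulmxA mulKmx //.
  by rewrite trmx_delta -rowE mxE.
have a0 : a i != 0.
  apply/negP => /eqP ai0; have := aMx (a i); rewrite ai0 => _.
  move: (aMx (delta_mx i 0)); rewrite ai0 bform0l !mxE !eqxx => /eqP.
  by rewrite eq_sym oner_eq0.
have c0 : 0 < qform M (a i) by apply: Mpos.2.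
(* Up to the factor [qform M (a i)], this vector is [x] minus its M-orthogonal projection on [a i].
   Scaling instead of dividing leaves [c * (c * q - b ^+ 2)], and [c] is positive. *)
have := posdef_qform_ge0 (qform M (a i) *: x + (- x i 0) *: a i) Mpos.
rewrite -[qform M (_ + _)]/(bform M _ _) !bform_Dl !bform_Dr.
rewrite !bform_Zl !bform_Zr (bform_sym x (a i) MT) aMx.
rewrite -[bform M x x]/(qform M x) -[bform M (a i) (a i)]/(qform M (a i)).
move: c0; set c := qform M (a i); set q := qform M x; set b := x i 0 => c0.
rewrite (_ : _ + _ = c * (c * q - b ^+ 2)); last by rewrite expr2; ring.
by rewrite pmulr_rge0 // subr_ge0.
Qed.

End BilinearForm.

(** * Trajectories as linear functions of initial state, inputs and noises *)

Section Trajectory.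
Variables (R : realType) (n m : nat) (A : 'M[R]_n) (B : 'M[R]_(n, m)).
Implicit Types (x : 'cV[R]_n) (u d : nat -> 'cV[R]_m) (v : nat -> 'cV[R]_n).

Fixpoint traj x u v t : 'cV[R]_n :=
  if t is s.+1 then A *m traj x u v s + B *m u s + v s else x.

Lemma eq_traj x u u' v v' t :
  (forall s, (s < t)%N -> u s = u' s) -> (forall s, (s < t)%N -> v s = v' s) ->
  traj x u v t = traj x u' v' t.
Proof.
elim: t => //= t IH uu vv; rewrite uu // vv // IH // => s st.
  by rewrite uu // ltnW.
by rewrite vv // ltnW.
Qed.

Lemma trajD x x' u u' v v' t :
  traj (x + x') (fun s => u s + u' s) (fun s => v s + v' s) t =
  traj x u v t + traj x' u' v' t.
Proof.
elim: t => //= t ->; rewrite !mulmxDr.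
by rewrite [A *m _ + A *m _ + _]addrACA [LHS]addrACA.
Qed.

Lemma trajZ a x u v t :
  traj (a *: x) (fun s => a *: u s) (fun s => a *: v s) t = a *: traj x u v t.
Proof. by elim: t => //= t ->; rewrite -!scalemxAr !scalerDr. Qed.

Lemma traj_free_forced x u v t :
  traj x u v t = traj x (fun=> 0) v t + traj 0 u (fun=> 0) t.
Proof.
rewrite -trajD addr0; apply: eq_traj => s _; by rewrite ?add0r ?addr0.
Qed.

(** The scalar [a] will be the value at one outcome of the indicator of an event, so the response to
    a pulse on that event is the indicator times a fixed trajectory. *)
Lemma traj_pulse a d t :
  traj 0 (fun s => a *: d s) (fun=> 0) t = a *: traj 0 d (fun=> 0) t.
Proof.
rewrite -trajZ scaler0; apply: eq_traj => s _ //; by rewrite scaler0.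
Qed.

End Trajectory.

(** * The bilinear cost and the Riccati recursion *)

Section Regulator.
Variables (R : realType) (n m : nat) (A : 'M[R]_n) (B : 'M[R]_(n, m)).
Variables (Q : 'M[R]_n) (Ru : 'M[R]_m) (S : 'M[R]_n).
Hypotheses (Q_pos : posdefmx Q) (Ru_pos : posdefmx Ru) (S_pos : posdefmx S).
Implicit Types (x y : nat -> 'cV[R]_n) (u d : nat -> 'cV[R]_m).

(** The polar form of the cost along a path. States and inputs are independent arguments, not tied
    by the dynamics, so it is bilinear and can also be evaluated on means. *)
Definition cost_form N x u y d : R :=
  \sum_(t < N) (bform Q (x t) (y t) + bform Ru (u t) (d t)) +
  bform S (x N) (y N).

Lemma eq_cost_form N x x' u u' y y' d d' :
  (forall t, (t <= N)%N -> x t = x' t) -> (forall t, (t < N)%N -> u t = u' t) ->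
  (forall t, (t <= N)%N -> y t = y' t) -> (forall t, (t < N)%N -> d t = d' t) ->
  cost_form N x u y d = cost_form N x' u' y' d'.
Proof.
move=> xx uu yy dd; rewrite /cost_form xx // yy //; congr (_ + _).
apply: eq_bigr => t _; have tN := ltn_ord t.
by rewrite xx ?yy ?uu ?dd // ltnW.
Qed.

Lemma cost_form_sym N x u y d : cost_form N x u y d = cost_form N y d x u.
Proof.
rewrite /cost_form (bform_sym _ _ S_pos.1); congr (_ + _).
apply: eq_bigr => t _.
by rewrite (bform_sym _ _ Q_pos.1) (bform_sym _ _ Ru_pos.1).
Qed.

Lemma cost_form_Dl N x x' u u' y d :
  cost_form N (fun t => x t + x' t) (fun t => u t + u' t) y d =
  cost_form N x u y d + cost_form N x' u' y d.
Proof.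
rewrite /cost_form bform_Dl addrACA -big_split /=; congr (_ + _).
by apply: eq_bigr => t _; rewrite !bform_Dl addrACA.
Qed.

Lemma cost_form_Zl N a x u y d :
  cost_form N (fun t => a *: x t) (fun t => a *: u t) y d =
  a * cost_form N x u y d.
Proof.
rewrite /cost_form bform_Zl mulrDr mulr_sumr; congr (_ + _).
by apply: eq_bigr => t _; rewrite !bform_Zl mulrDr.
Qed.

Lemma cost_form_perturb N e x u y d :
  cost_form N (fun t => x t + e *: y t) (fun t => u t + e *: d t)
              (fun t => x t + e *: y t) (fun t => u t + e *: d t) =
  cost_form N x u x u + 2 * e * cost_form N x u y d
  + e ^+ 2 * cost_form N y d y d.
Proof.
rewrite cost_form_Dl cost_form_Zl.
rewrite [cost_form N x u _ _]cost_form_sym [cost_form N y d _ _]cost_form_sym.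
rewrite !cost_form_Dl !cost_form_Zl [cost_form N y d x u]cost_form_sym.
by rewrite expr2; ring.
Qed.

Lemma cost_form_ge0 N x u : 0 <= cost_form N x u x u.
Proof.
apply: addr_ge0; last exact: posdef_qform_ge0.
by apply: sumr_ge0 => t _; apply: addr_ge0; exact: posdef_qform_ge0.
Qed.

(** Used twice: a finite cost makes the inputs square-integrable, and a vanishing second variation
    makes the perturbation vanish. *)
Lemma qform_input_le_cost N x u t :
  (t < N)%N -> qform Ru (u t) <= cost_form N x u x u.
Proof.
move=> tN; rewrite /cost_form (bigD1 (Ordinal tN)) //=.
rewrite -[bform Ru (u t) (u t)]/(qform Ru (u t)).
rewrite [bform Q _ _ + _]addrC -!addrA lerDl.
rewrite !addr_ge0 //; try exact: posdef_qform_ge0.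
by apply: sumr_ge0 => s _; apply: addr_ge0; exact: posdef_qform_ge0.
Qed.

Local Notation gain := (gain_of A B Ru).
Local Notation ctg := (cost_to_go A B Q Ru S).

(** Half the second derivative in [u] of the one-step Bellman cost [u'Ru u + (Ax+Bu)'P(Ax+Bu)]; it
    is the matrix inverted in [gain_of]. *)
Definition hessian (P : 'M[R]_n) : 'M[R]_m := B^T *m P *m B + Ru.

Lemma hessian_posdef (P : 'M[R]_n) :
  P^T = P -> (forall z : 'cV_n, 0 <= qform P z) -> posdefmx (hessian P).
Proof.
move=> PT P0; split=> [|u u0].
  by rewrite /hessian linearD /= !trmx_mul trmxK PT Ru_pos.1 mulmxA.
rewrite /hessian /qform mulmxDr mulmxDl mxE ltr_wpDl //; last exact: Ru_pos.2.
by have := P0 (B *m u); rewrite /qform trmx_mul !mulmxA.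
Qed.

(* The feedback [d = - gain P y] annihilates the coefficient of [u], which is
   what makes the cost-to-go matrix the same on both sides. *)
Lemma riccati_step (P : 'M[R]_n) (x y : 'cV[R]_n) (u : 'cV[R]_m) :
  hessian P \in unitmx ->
  bform Q x y + bform Ru u (- (gain P *m y)) +
  bform P (A *m x + B *m u) (A *m y + B *m - (gain P *m y)) =
  bform (Q + A^T *m P *m A - A^T *m P *m B *m gain P) x y.
Proof.
move=> Hu; set H := gain P.
(* The normal equation [hessian P *m H = B^T *m P *m A], solved for [Ru *m H]. *)
have HE : Ru *m H = B^T *m P *m A - B^T *m P *m B *m H.
  apply/eqP; rewrite eq_sym subr_eq addrC -mulmxDl; apply/eqP.
  by rewrite /H /gain_of -/(hessian P) mulmxA mulmxV // mul1mx.
have -> : bform Ru u (- (H *m y)) =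
          - (u^T *m (B^T *m P *m A - B^T *m P *m B *m H) *m y) 0 0.
  by rewrite /bform mulmxN mxE -HE !mulmxA.
rewrite /bform [(_ + _)^T]linearD /= !trmx_mul.
do ![rewrite ?(mulmxDl, mulmxDr, mulmxBl, mulmxBr, mulmxN, mulNmx, mulmxA)].
rewrite !(addmxE, oppmxE); lra.
Qed.

(** The Riccati recursion subtracts a term, so positivity is not visible in it. With the feedback
    input on both sides, [riccati_step] rewrites the next form as a sum of three nonnegative
    terms. *)
Lemma ctg_psd k : (ctg k)^T = ctg k /\ forall z : 'cV_n, 0 <= qform (ctg k) z.
Proof.
elim: k => [|k [PT P0]] /=.
  by split=> [|x]; [exact: S_pos.1 | exact: posdef_qform_ge0].
have Hpos := hessian_posdef PT P0; have Hu := posdef_unitmx Hpos.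
split=> [|x].
  rewrite linearB linearD /= Q_pos.1 !trmx_mul !trmxK PT; congr (_ + _ - _).
    by rewrite mulmxA.
  rewrite /gain_of -/(hessian _) trmx_inv Hpos.1.
  by rewrite !mulmxA.
rewrite -[qform _ x]/(bform _ x x) -(@riccati_step _ x x (- (gain (ctg k) *m x))) //.
by rewrite !addr_ge0 //; [exact: posdef_qform_ge0..|exact: P0].
Qed.

Lemma ctg_hessian_unit k : hessian (ctg k) \in unitmx.
Proof. by have [PT P0] := ctg_psd k; exact/posdef_unitmx/hessian_posdef. Qed.

Section Stationary.
Variables (N t : nat) (tN : (t < N)%N).
Variable a : 'cV[R]_m.

Definition pulse_gain s (y : 'cV[R]_n) : 'cV[R]_m :=
  if (s < t)%N then 0 else if s == t then a else - (lqr_gain A B Q Ru S N s *m y).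

(** The perturbation is generated in closed loop, then read off as the open-loop sequence
    [pulse_input]. It is deterministic, hence a legitimate direction for the first variation. *)
Fixpoint pulse_state s : 'cV[R]_n :=
  if s is r.+1 then A *m pulse_state r + B *m pulse_gain r (pulse_state r) else 0.

Definition pulse_input s := pulse_gain s (pulse_state s).

Lemma pulse_traj s : traj A B 0 pulse_input (fun=> 0) s = pulse_state s.
Proof. by elim: s => //= s ->; rewrite addr0. Qed.

Lemma pulse_state0 s : (s <= t)%N -> pulse_state s = 0.
Proof.
elim: s => //= s IH st; rewrite IH ?(ltnW st) // /pulse_gain st.
by rewrite !mulmx0 addr0.
Qed.

(** Backward induction from the horizon: each [riccati_step] absorbs one stage, whatever the inputs
    [u] are. The bound on [k] keeps all times of the sum after [t], where the pulse follows the
    regulator feedback. *)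
Lemma pulse_tail_cost x u k :
  (forall s, (t < s < N)%N -> x s.+1 = A *m x s + B *m u s) ->
  (k < N - t)%N ->
  \sum_(N - k <= s < N) (bform Q (x s) (pulse_state s)
                         + bform Ru (u s) (pulse_input s))
  + bform S (x N) (pulse_state N) =
  bform (ctg k) (x (N - k)%N) (pulse_state (N - k)%N).
Proof.
move=> xS; elim: k => [|k IH] kN; first by rewrite subn0 big_geq // add0r.
have sE : (N - k = (N - k.+1).+1)%N by lia.
have st : (t < N - k.+1)%N by lia.
rewrite big_ltn; last by lia.
rewrite -sE -addrA IH; last by lia.
rewrite sE /= xS; last by lia.
rewrite /pulse_input /pulse_gain ltnNge (ltnW st) /= (gtn_eqF st).
(* At time [N - k.+1] the regulator gain is built from the matrix with [k] steps left, the one in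
   the induction hypothesis. *)
rewrite /lqr_gain -sE (_ : N - (N - k) = k)%N; last by lia.
by rewrite riccati_step // ctg_hessian_unit.
Qed.

End Stationary.

(** The sequences will be means over an event of the past at [t]. Such means obey the noise-free
    dynamics only from [t] on, whence the range of [s] in the second hypothesis. *)
Lemma lqr_stationary N t x u :
  (t < N)%N ->
  (forall s, (t <= s < N)%N -> x s.+1 = A *m x s + B *m u s) ->
  (forall d, (forall s, (s < t)%N -> d s = 0) ->
     cost_form N x u (traj A B 0 d (fun=> 0)) d = 0) ->
  u t = - (lqr_gain A B Q Ru S N t *m x t).
Proof.
move=> tN xS stat; pose P := ctg (N - t.+1).
have xS' s : (t < s < N)%N -> x s.+1 = A *m x s + B *m u s.
  by move=> /andP[ts sN]; rewrite xS // ltnW.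
(* [key] is stationarity of the Bellman cost at time [t] in the direction [a]; letting [a] run
   through the basis gives [hessian P *m u t = - B^T *m P *m A *m x t]. *)
suff key a : bform Ru (u t) a + bform P (A *m x t + B *m u t) (B *m a) = 0.
  have Hu : hessian P \in unitmx by exact: ctg_hessian_unit.
  have /eqP : hessian P *m u t + B^T *m P *m A *m x t = 0.
    apply/matrixP => i j; rewrite ord1 {j} [in RHS]mxE -(key (delta_mx i 0)).
    rewrite -[RHS]/(_ + bform P _ _) (bform_sym _ _ Ru_pos.1).
    rewrite (bform_sym _ _ (ctg_psd _).1) /bform trmx_mul.
    set e := delta_mx i 0; rewrite -[RHS]/(((e^T *m Ru *m u t) 0 0) + _).
    have row0 (z : 'cV[R]_m) : z i 0 = (e^T *m z) 0 0.
      by rewrite /e trmx_delta -rowE mxE.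
    rewrite !addmxE !row0 /hessian !mulmxDl !mulmxDr !mulmxA.
    rewrite !addmxE; lra.
  rewrite addr_eq0 => /eqP/(congr1 (mulmx (invmx (hessian P)))).
  by rewrite mulKmx // mulmxN /lqr_gain /gain_of !mulmxA.
have /stat : forall s, (s < t)%N -> pulse_input N t a s = 0.
  by move=> s st; rewrite /pulse_input /pulse_gain st.
rewrite (_ : cost_form _ _ _ _ _ =
    cost_form N x u (pulse_state N t a) (pulse_input N t a)); last first.
  by apply: eq_cost_form => // s _; rewrite pulse_traj.
rewrite /cost_form -(big_mkord xpredT (fun s =>
  bform Q (x s) (pulse_state N t a s) + bform Ru (u s) (pulse_input N t a s))).
rewrite (@big_cat_nat _ _ _ t.+1) //= -addrA.
have := @pulse_tail_cost N t tN a x u (N - t.+1) xS'.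
rewrite (_ : N - (N - t.+1) = t.+1)%N; last by lia.
move=> ->; last by lia.
rewrite big_nat_recr //= big1_seq ?add0r; last first.
  move=> s; rewrite mem_index_iota => /andP[_ /andP[_ st]].
  rewrite pulse_state0 ?(ltnW st) // /pulse_input /pulse_gain st.
  by rewrite !bform0r addr0.
rewrite pulse_state0 // bform0r add0r /pulse_input /pulse_gain ltnn eqxx.
by rewrite mulmx0 add0r xS ?leqnn.
Qed.

End Regulator.

(** * Measurability of matrix-valued maps *)

Section MatrixMeasurability.
Variables (R : realType) (d : measure_display) (T : measurableType d).

Lemma measurable_mxP m n (f : T -> 'M[R]_(m, n)) :
  measurable_fun setT f <-> forall i j, measurable_fun setT (fun o => f o i j).
Proof.
split=> [mf i j|mf].
  have me : measurable_fun setT (fun M : 'M[R]_(m, n) => M i j).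
    move=> _ B mB; apply: sub_sigma_algebra; exists (i, j) => //.
    by exists B.
  exact: (measurableT_comp me mf).
apply: (@measurability _ _ _ _ _ _ (@mx_entries R m n)) => //.
move=> _ [_ [[i j] _ [B mB <-]] <-]; rewrite !setTI.
by rewrite -[X in measurable X]setTI; exact: mf.
Qed.

Lemma measurable_addmx m n (f g : T -> 'M[R]_(m, n)) :
  measurable_fun setT f -> measurable_fun setT g ->
  measurable_fun setT (fun o => f o + g o).
Proof.
move=> /measurable_mxP mf /measurable_mxP mg; apply/measurable_mxP => i j.
under eq_fun do rewrite mxE; exact: measurable_funD.
Qed.

Lemma measurable_mulmx m n k (M : 'M[R]_(m, n)) (f : T -> 'M[R]_(n, k)) :
  measurable_fun setT f -> measurable_fun setT (fun o => M *m f o).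
Proof.
move=> /measurable_mxP mf; apply/measurable_mxP => i j.
under eq_fun do rewrite mxE; apply: measurable_sum => s.
exact: measurable_funM.
Qed.

Lemma measurable_oppmx m n (f : T -> 'M[R]_(m, n)) :
  measurable_fun setT f -> measurable_fun setT (fun o => - f o).
Proof.
move=> /measurable_mxP mf; apply/measurable_mxP => i j.
under eq_fun do rewrite mxE; exact: measurableT_comp.
Qed.

Lemma measurable_scalemx m n (a : T -> R) (f : T -> 'M[R]_(m, n)) :
  measurable_fun setT a -> measurable_fun setT f ->
  measurable_fun setT (fun o => a o *: f o).
Proof.
move=> ma /measurable_mxP mf; apply/measurable_mxP => i j.
under eq_fun do rewrite mxE; exact: measurable_funM.
Qed.

Lemma measurable_dsubmx m1 m2 n (f : T -> 'M[R]_(m1 + m2, n)) :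
  measurable_fun setT f -> measurable_fun setT (fun o => dsubmx (f o)).
Proof.
move=> /measurable_mxP mf; apply/measurable_mxP => i j.
under eq_fun do rewrite mxE; exact: mf.
Qed.

Lemma measurable_col_mx m1 m2 n (f : T -> 'M[R]_(m1, n))
    (g : T -> 'M[R]_(m2, n)) :
  measurable_fun setT f -> measurable_fun setT g ->
  measurable_fun setT (fun o => col_mx (f o) (g o)).
Proof.
move=> /measurable_mxP mf /measurable_mxP mg; apply/measurable_mxP => i j.
under eq_fun do rewrite mxE; case: (fintype.split i) => k; [exact: mf|exact: mg].
Qed.

Lemma measurable_rcons_mx k t (f : T -> 'M[R]_(k, t)) (g : T -> 'cV[R]_k) :
  measurable_fun setT f -> measurable_fun setT g ->
  measurable_fun setT (fun o => rcons_mx (f o) (g o)).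
Proof.
move=> /measurable_mxP mf /measurable_mxP mg; apply/measurable_mxP => i j.
under eq_fun do rewrite mxE; case: (unlift ord_max j) => [s|];
  [exact: mf|exact: mg].
Qed.

Lemma measurable_traj n m (A : 'M[R]_n) (B : 'M[R]_(n, m)) (x : T -> 'cV[R]_n)
    (u : T -> nat -> 'cV[R]_m) (v : T -> nat -> 'cV[R]_n) t :
  measurable_fun setT x ->
  (forall s, (s < t)%N -> measurable_fun setT (u ^~ s)) ->
  (forall s, (s < t)%N -> measurable_fun setT (v ^~ s)) ->
  measurable_fun setT (fun o => traj A B (x o) (u o) (v o) t).
Proof.
move=> mx; elim: t => //= t IH mu mv.
apply: measurable_addmx; last exact: mv.
apply: measurable_addmx; apply: measurable_mulmx; last exact: mu.
by apply: IH => s st; [exact/mu/ltnW | exact/mv/ltnW].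
Qed.

Definition cols k t (Y : nat -> 'cV[R]_k) : 'M[R]_(k, t) :=
  \matrix_(i, s) Y s i 0.

(** The padding by 0 only makes a matrix of inputs acceptable to [traj]; up to time [t] a trajectory
    reads genuine columns. *)
Definition col_seq k t (M : 'M[R]_(k, t)) (s : nat) : 'cV[R]_k :=
  if insub s is Some j then col j M else 0.

Lemma col_seq_cols k t (Y : nat -> 'cV[R]_k) s :
  (s < t)%N -> col_seq (cols t Y) s = Y s.
Proof.
move=> st; rewrite /col_seq insubT; apply/matrixP => i j.
by rewrite ord1 !mxE.
Qed.

Lemma rcons_cols k t (Y : nat -> 'cV[R]_k) :
  rcons_mx (cols t Y) (Y t) = cols t.+1 Y.
Proof.
apply/matrixP => i j; rewrite !mxE; case: unliftP => [s ->|-> //].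
by rewrite mxE lift_max.
Qed.

Lemma eq_cols k t (Y Z : nat -> 'cV[R]_k) :
  (forall s, (s < t)%N -> Y s = Z s) -> cols t Y = cols t Z.
Proof. by move=> YZ; apply/matrixP => i j; rewrite !mxE YZ. Qed.

Lemma measurable_cols k t (Y : T -> nat -> 'cV[R]_k) :
  (forall s, (s < t)%N -> measurable_fun setT (Y ^~ s)) ->
  measurable_fun setT (fun o => cols t (Y o)).
Proof.
move=> mY; apply/measurable_mxP => i j; under eq_fun do rewrite mxE.
by have /measurable_mxP := mY j (ltn_ord j); exact.
Qed.

Lemma measurable_col_seq k t s (f : T -> 'M[R]_(k, t)) :
  measurable_fun setT f -> measurable_fun setT (fun o => col_seq (f o) s).
Proof.
move=> /measurable_mxP mf; rewrite /col_seq; case: insubP => [j _ _|_] //.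
apply/measurable_mxP => i l; under eq_fun do rewrite mxE; exact: mf.
Qed.

End MatrixMeasurability.

(** * Laws and controls driven by the uncontrolled output *)

Section Controls.
Variables (R : realType) (d : measure_display) (T : measurableType d).
Variables (n m1 m2 p1 p2 N : nat).
Variables (A : 'M[R]_n) (B : 'M[R]_(n, m1 + m2)) (C : 'M[R]_(p1 + p2, n)).
Variables (x0 : T -> 'cV[R]_n) (v : nat -> T -> 'cV[R]_n).
Variable w : nat -> T -> 'cV[R]_(p1 + p2).

Local Notation m := (m1 + m2)%N.
Local Notation p := (p1 + p2)%N.
Local Notation law := (law R m1 m2 p1 p2).
Local Notation state := (state A B C x0 v w).
Local Notation past := (past A B C x0 v w).
Local Notation output := (output A B C x0 v w).
Local Notation input := (input A B C x0 v w).
Local Notation traj := (traj A B).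

Lemma closed_loopS (g : law) t o :
  state g t.+1 o = A *m state g t o + B *m input g t o + v t o /\
  past g t.+1 o = (rcons_mx (past g t o).1 (output g t o),
                   rcons_mx (past g t o).2 (input g t o)).
Proof.
rewrite /Defs.input /Defs.output /Defs.state /Defs.past /=.
by case: (closed_loop _ _ _ _ _ _ _ t o) => x h.
Qed.

Lemma stateE g t o : state g t o = traj (x0 o) (input g ^~ o) (v ^~ o) t.
Proof. by elim: t => //= t <-; exact: (closed_loopS g t o).1. Qed.

Lemma pastE g t o :
  past g t o = (cols t (output g ^~ o), cols t (input g ^~ o)).
Proof.
elim: t => [|t IH].
  by congr pair; apply/matrixP => i [].
by rewrite (closed_loopS g t o).2 IH -!rcons_cols.
Qed.

Definition free_output t o := C *m traj (x0 o) (fun=> 0) (v ^~ o) t + w t o.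

Definition free_past t o : 'M[R]_(p, t) := cols t (free_output ^~ o).

Lemma measurable_free_past t : measurable_fun setT x0 ->
  (forall s, (s < t)%N -> measurable_fun setT (v s)) ->
  (forall s, (s < t)%N -> measurable_fun setT (w s)) ->
  measurable_fun setT (@free_past t).
Proof.
move=> mx mv mw; apply: measurable_cols => s st.
apply: measurable_addmx; last exact: mw.
apply: measurable_mulmx; apply: measurable_traj => // r rs.
by apply: mv; exact: ltn_trans st.
Qed.

Definition forced_state t (U : 'M[R]_(m, t)) s :=
  traj 0 (col_seq U) (fun=> 0) s.

Lemma forced_stateE t (u : nat -> 'cV[R]_m) s :
  (s <= t)%N -> forced_state (cols t u) s = traj 0 u (fun=> 0) s.
Proof.
move=> st; apply: eq_traj => // r rs; rewrite col_seq_cols //.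
exact: leq_trans rs st.
Qed.

(** The forced term depends on inputs before [t] only, which both players have recorded. Each can
    subtract it from the outputs observed, the second player block by block, so the information
    pattern is preserved. *)
Lemma outputE g t o :
  output g t o = free_output t o + C *m traj 0 (input g ^~ o) (fun=> 0) t.
Proof.
by rewrite /Defs.output stateE traj_free_forced mulmxDr /free_output addrAC.
Qed.

(* The controls are measurable functions of the outputs of the uncontrolled
   system, whose information pattern does not depend on the control. *)
Definition control (u : nat -> T -> 'cV[R]_m) : Prop :=
  exists c1 : forall t, 'M[R]_(p, t) * 'cV[R]_p -> 'cV[R]_m1,
  exists c2 : forall t, 'M[R]_(p, t) * 'cV[R]_p2 -> 'cV[R]_m2,
    (forall t, (t < N)%N ->
       measurable_fun setT (c1 t) /\ measurable_fun setT (c2 t)) /\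
    forall t o, u t o = col_mx (c1 t (free_past t o, free_output t o))
                               (c2 t (free_past t o, dsubmx (free_output t o))).

Lemma control_realized u : control u ->
  exists2 g : law, admissible N g & forall t o, input g t o = u t o.
Proof.
case=> c1 [c2 [mc uE]].
(* [fo] is the forced part of the output at [t], and [fp] the record of free outputs, both
   recomputed from the actual history. *)
pose fo t (U : 'M[R]_(m, t)) : 'cV[R]_p := C *m forced_state U t.
pose fp t (h : history R p m t) : 'M[R]_(p, t) :=
  h.1 - cols t (fun s => C *m forced_state h.2 s).
pose g : law := Law
  (fun t (hy : history R p m t * 'cV[R]_p) =>
     c1 t (fp t hy.1, hy.2 - fo t hy.1.2))
  (fun t (hy : history R p m t * 'cV[R]_p2) =>
     c2 t (fp t hy.1, hy.2 - dsubmx (fo t hy.1.2))).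
have mfs d' (U : measurableType d') t (h : U -> 'M[R]_(m, t)) s :
    measurable_fun setT h ->
    measurable_fun setT (fun o => C *m forced_state (h o) s).
  move=> mh; apply: measurable_mulmx; apply: measurable_traj => // r _.
  exact: measurable_col_seq.
have mfp d' (U : measurableType d') t (h : U -> history R p m t) :
    measurable_fun setT h -> measurable_fun setT (fun o => fp t (h o)).
  move=> mh; apply: measurable_addmx; first exact: measurableT_comp.
  apply: measurable_oppmx; apply: measurable_cols => s _; apply: mfs.
  exact: measurableT_comp.
exists g => [t tN|t o].
  have [m1c m2c] := mc t tN; split.
    apply: (measurableT_comp m1c); apply: measurable_fun_pair; first exact: mfp.
    apply: measurable_addmx => //; apply: measurable_oppmx; apply: mfs.
    by apply: measurableT_comp => //; exact: measurableT_comp.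
  apply: (measurableT_comp m2c); apply: measurable_fun_pair; first exact: mfp.
  apply: measurable_addmx => //; apply/measurable_oppmx/measurable_dsubmx/mfs.
  by apply: measurableT_comp => //; exact: measurableT_comp.
have foE : fo t (past g t o).2 = C *m traj 0 (input g ^~ o) (fun=> 0) t.
  by rewrite pastE /fo forced_stateE.
have fpE : fp t (past g t o) = free_past t o.
  rewrite pastE /fp /=; apply/eqP; rewrite subr_eq; apply/eqP/matrixP => i s.
  rewrite addmxE [LHS]mxE [X in X + _]mxE [X in _ + X]mxE outputE addmxE.
  by rewrite forced_stateE // ltnW.
rewrite uE /Defs.input /apply_law /= fpE foE outputE addrK.
by rewrite -linearB /= addrK.
Qed.

(** The converse of the subtraction in [control_realized]: run the law on a record of free outputs,
    restoring each actual output from the inputs already computed. [cols s (col_seq Z)] drops the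
    last column. *)
Fixpoint replay (g : law) t : 'M[R]_(p, t) -> history R p m t :=
  if t is s.+1 then fun Z =>
    let h := replay g (cols s (col_seq Z)) in
    let y := col_seq Z s + C *m forced_state h.2 s in
    (rcons_mx h.1 y, rcons_mx h.2 (apply_law g h y))
  else fun=> (0, 0).

Lemma replayE g t o : past g t o = replay g (free_past t o).
Proof.
elim: t => // t IH; rewrite (closed_loopS g t o).2 /= col_seq_cols //.
have -> : cols t (col_seq (free_past t.+1 o)) = free_past t o.
  by apply: eq_cols => s st; rewrite col_seq_cols // ltnW.
have yE : free_output t o + C *m forced_state (past g t o).2 t = output g t o.
  by rewrite outputE pastE forced_stateE.
by rewrite -IH yE.
Qed.

Lemma measurable_apply_law (g : law) t d' (U : measurableType d')
    (h : U -> history R p m t) (y : U -> 'cV[R]_p) :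
  admissible N g -> (t < N)%N ->
  measurable_fun setT h -> measurable_fun setT y ->
  measurable_fun setT (fun o => apply_law g (h o) (y o)).
Proof.
move=> gadm tN mh my; have [ml1 ml2] := gadm t tN.
apply: measurable_col_mx.
  by apply: (measurableT_comp ml1); exact: measurable_fun_pair.
apply: (measurableT_comp ml2); apply: measurable_fun_pair => //.
exact: measurable_dsubmx.
Qed.

Lemma measurable_replay g t : admissible N g -> (t <= N)%N ->
  measurable_fun setT (@replay g t).
Proof.
move=> gadm; elim: t => //= t IH tN.
have mh : measurable_fun setT
    (fun Z : 'M[R]_(p, t.+1) => replay g (cols t (col_seq Z))).
  apply: measurableT_comp; first exact: IH (ltnW tN).
  by apply: measurable_cols => s _; exact: measurable_col_seq.
have my : measurable_fun setT (fun Z : 'M[R]_(p, t.+1) => col_seq Z t +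
    C *m forced_state (replay g (cols t (col_seq Z))).2 t).
  apply: measurable_addmx; first exact: measurable_col_seq.
  apply: measurable_mulmx; apply: measurable_traj => // r _.
  by apply: measurable_col_seq; exact: (measurableT_comp measurable_snd).
apply: measurable_fun_pair; apply: measurable_rcons_mx => //.
- exact: (measurableT_comp measurable_fst mh).
- exact: (measurableT_comp measurable_snd mh).
- exact: measurable_apply_law.
Qed.

Lemma input_control g : admissible N g -> control (input g).
Proof.
move=> gadm; pose fo t (Z : 'M[R]_(p, t)) := C *m forced_state (replay g Z).2 t.
exists (fun t Zz => law1 g (replay g Zz.1, Zz.2 + fo t Zz.1)).
exists (fun t Zz => law2 g (replay g Zz.1, Zz.2 + dsubmx (fo t Zz.1))).
split=> [t tN|t o].
  have [ml1 ml2] := gadm t tN; have mr := measurable_replay gadm (ltnW tN).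
  have mfo : measurable_fun setT (fo t).
    apply: measurable_mulmx; apply: measurable_traj => // r _.
    by apply: measurable_col_seq; exact: (measurableT_comp measurable_snd).
  split.
    apply: (measurableT_comp ml1); apply: measurable_fun_pair => /=.
      exact: measurableT_comp.
    by apply: measurable_addmx => //; exact: measurableT_comp.
  apply: (measurableT_comp ml2); apply: measurable_fun_pair => /=.
    exact: measurableT_comp.
  apply: measurable_addmx => //; apply: measurable_dsubmx.
  exact: measurableT_comp.
have foE : fo t (free_past t o) = C *m traj 0 (input g ^~ o) (fun=> 0) t.
  by rewrite /fo -replayE pastE forced_stateE.
by rewrite -replayE foE {1}/Defs.input /apply_law outputE linearD.
Qed.

Lemma control_perturb u1 u2 a : control u1 -> control u2 ->
  control (fun t o => u1 t o + a *: u2 t o).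
Proof.
case=> c1 [c2 [mc u1E]] [e1 [e2 [me u2E]]].
exists (fun t zz => c1 t zz + a *: e1 t zz).
exists (fun t zz => c2 t zz + a *: e2 t zz); split=> [t tN|t o]; last first.
  by rewrite u1E u2E scale_col_mx add_col_mx.
have [? ?] := mc t tN; have [? ?] := me t tN.
by split; apply: measurable_addmx => //; exact: measurable_scalemx.
Qed.

(** From time [t] on, both players know whether the event has occurred; before [t] the vectors are
    zero, so nothing is anticipated. *)
Lemma control_pulse t (D : set 'M[R]_(p, t)) (e : nat -> 'cV[R]_m) :
  measurable D -> (forall s, (s < t)%N -> e s = 0) ->
  control (fun s o => \1_(free_past t @^-1` D) o *: e s).
Proof.
(* For [s >= t], [trunc] keeps the first [t] columns of the longer record. For [s < t] it pads with
   zeros, harmlessly since [e s = 0]. *)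
move=> mD e0; pose trunc s (Z : 'M[R]_(p, s)) : 'M[R]_(p, t) := cols t (col_seq Z).
exists (fun s zz => \1_D (trunc s zz.1) *: usubmx (e s)).
exists (fun s zz => \1_D (trunc s zz.1) *: dsubmx (e s)); split=> [s sN|s o].
  have mt : measurable_fun setT (trunc s).
    by apply: measurable_cols => r _; exact: measurable_col_seq.
  split; apply: measurable_scalemx => //;
    apply: (measurableT_comp (measurable_indic mD));
    exact: measurableT_comp.
rewrite -scale_col_mx vsubmxK; have [st|ts] := ltnP s t.
  by rewrite e0 // !scaler0.
rewrite (_ : trunc _ _ = free_past t o) //; apply: eq_cols => r rt.
by rewrite col_seq_cols // (leq_trans rt ts).
Qed.

End Controls.

(** * Square-integrable vectors and their means over events *)

Section SquareIntegrable.
Variables (R : realType) (d : measure_display) (T : measurableType d).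
Variable P : probability T R.
Implicit Types f g : T -> R.

Definition intr f := P.-integrable setT (EFin \o f).

Lemma eq_intr f g : f =1 g -> intr f -> intr g.
Proof. by move=> /funext ->. Qed.

Lemma intrD f g : intr f -> intr g -> intr (fun o => f o + g o).
Proof. by move=> fi gi; exact: (integrableD measurableT fi gi). Qed.

Lemma intrZ a f : intr f -> intr (fun o => a * f o).
Proof. by move=> fi; exact: (integrableZl measurableT a fi). Qed.

Lemma intr0 : intr (fun=> 0).
Proof. exact: integrable0. Qed.

Lemma intr_sum I (r : seq I) (Q : pred I) (F : I -> T -> R) :
  (forall i, intr (F i)) -> intr (fun o => \sum_(i <- r | Q i) F i o).
Proof.
move=> Fi; elim: r => [|i r IH].
  by under eq_fun do rewrite big_nil; exact: intr0.
under eq_fun do rewrite big_cons; case: (Q i) => //; exact: intrD.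
Qed.

Lemma le_intr f g : measurable_fun setT f -> (forall o, `|f o| <= g o) ->
  intr g -> intr f.
Proof.
move=> mf fg; apply: (le_integrable measurableT); first exact/measurable_EFinP.
by move=> o _ /=; rewrite lee_fin (le_trans (fg o)) // ler_norm.
Qed.

Definition sqint f := measurable_fun setT f /\ intr (fun o => f o ^+ 2).

Lemma sqint_mul f g : sqint f -> sqint g -> intr (fun o => f o * g o).
Proof.
move=> [mf fi] [mg gi]; apply: le_intr (intrD fi gi) => [|o].
  exact: measurable_funM.
rewrite normrM -(real_normK (num_real (f o))) -(real_normK (num_real (g o))).
by have := sqr_ge0 (`|f o| - `|g o|); rewrite !expr2; nra.
Qed.

Lemma sqint_cst a : sqint (fun=> a).
Proof.
by split=> //; exact: (finite_measure_integrable_cst P (a ^+ 2) measurableT).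
Qed.

Lemma sqint_intr f : sqint f -> intr f.
Proof.
move=> fs; by apply: eq_intr (sqint_mul fs (sqint_cst 1)) => o; rewrite mulr1.
Qed.

Lemma sqintZ a f : sqint f -> sqint (fun o => a * f o).
Proof.
move=> [mf fi]; split; first exact: measurable_funM.
by apply: eq_intr (intrZ (a ^+ 2) fi) => o; rewrite exprMn.
Qed.

Lemma sqintD f g : sqint f -> sqint g -> sqint (fun o => f o + g o).
Proof.
move=> fs gs; split; first exact: measurable_funD fs.1 gs.1.
have := intrD (intrD fs.2 gs.2) (intrZ 2 (sqint_mul fs gs)).
apply: eq_intr => o; by rewrite !expr2; ring.
Qed.

Lemma sqint_sum I (r : seq I) (F : I -> T -> R) :
  (forall i, sqint (F i)) -> sqint (fun o => \sum_(i <- r) F i o).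
Proof.
move=> Fs; elim: r => [|i r IH].
  by under eq_fun do rewrite big_nil; exact: sqint_cst.
by under eq_fun do rewrite big_cons; exact: sqintD.
Qed.

Lemma sqint_indic (E : set T) : measurable E -> sqint \1_E.
Proof.
move=> mE; have mI : measurable_fun setT (\1_E : T -> R) by exact: measurable_indic.
split=> //; apply: le_intr (sqint_intr (sqint_cst 1)) => [|o].
  exact: measurable_funX.
by rewrite indicE; case: (o \in E); rewrite ?expr1n ?expr0n /= ?normr1 ?normr0.
Qed.

Definition sqint_vec k (X : T -> 'cV[R]_k) := forall i, sqint (fun o => X o i 0).
Definition intr_vec k (X : T -> 'cV[R]_k) := forall i, intr (fun o => X o i 0).

Lemma sqint_intr_vec k (X : T -> 'cV[R]_k) : sqint_vec X -> intr_vec X.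
Proof. by move=> Xs i; exact: sqint_intr. Qed.

Lemma sqint_addmx k (X Y : T -> 'cV[R]_k) :
  sqint_vec X -> sqint_vec Y -> sqint_vec (fun o => X o + Y o).
Proof. by move=> Xs Ys i; under eq_fun do rewrite mxE; exact: sqintD. Qed.

Lemma sqint_mulmx k l (M : 'M[R]_(l, k)) (X : T -> 'cV[R]_k) :
  sqint_vec X -> sqint_vec (fun o => M *m X o).
Proof.
move=> Xs i; under eq_fun do rewrite mxE.
by apply: sqint_sum => j; exact: sqintZ.
Qed.

Lemma sqint_scalemx k a (X : T -> 'cV[R]_k) :
  sqint_vec X -> sqint_vec (fun o => a *: X o).
Proof. by move=> Xs i; under eq_fun do rewrite mxE; exact: sqintZ. Qed.

Lemma sqint_pulse k (E : set T) (a : 'cV[R]_k) :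
  measurable E -> sqint_vec (fun o => \1_E o *: a).
Proof.
move=> mE i; under eq_fun do rewrite mxE mulrC.
exact/sqintZ/sqint_indic.
Qed.

Lemma sqint_traj n m (A : 'M[R]_n) (B : 'M[R]_(n, m)) (x : T -> 'cV[R]_n)
    (u : nat -> T -> 'cV[R]_m) (v : nat -> T -> 'cV[R]_n) t :
  sqint_vec x -> (forall s, (s < t)%N -> sqint_vec (u s)) ->
  (forall s, (s < t)%N -> sqint_vec (v s)) ->
  sqint_vec (fun o => traj A B (x o) (u ^~ o) (v ^~ o) t).
Proof.
move=> xs; elim: t => //= t IH us vs.
apply: sqint_addmx; last exact: vs.
apply: sqint_addmx; apply: sqint_mulmx; last exact: us.
by apply: IH => s st; [exact: us (ltnW st) | exact: vs (ltnW st)].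
Qed.

Lemma intr_bform k (M : 'M[R]_k) (X Y : T -> 'cV[R]_k) :
  sqint_vec X -> sqint_vec Y -> intr (fun o => bform M (X o) (Y o)).
Proof.
move=> Xs Ys; under eq_fun do rewrite bform_entries.
apply: intr_sum => i; apply: intr_sum => j; apply: intrZ.
exact: sqint_mul.
Qed.

Lemma intr_cost_form n m (Q : 'M[R]_n) (Ru : 'M[R]_m) (S : 'M[R]_n) N
    (x y : nat -> T -> 'cV[R]_n) (u e : nat -> T -> 'cV[R]_m) :
  (forall t, (t <= N)%N -> sqint_vec (x t)) ->
  (forall t, (t < N)%N -> sqint_vec (u t)) ->
  (forall t, (t <= N)%N -> sqint_vec (y t)) ->
  (forall t, (t < N)%N -> sqint_vec (e t)) ->
  intr (fun o => cost_form Q Ru S N (x ^~ o) (u ^~ o) (y ^~ o) (e ^~ o)).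
Proof.
move=> xs us ys es; apply: intrD; last by apply: intr_bform; [exact: xs|exact: ys].
apply: intr_sum => t; have tN := ltn_ord t.
by apply: intrD; apply: intr_bform;
  [exact: xs (ltnW tN) | exact: ys (ltnW tN) | exact: us | exact: es].
Qed.

(** With mean zero, the second moment is the diagonal covariance, which [centered_gaussian] makes a
    real number; no Gaussian integral is computed. *)
Lemma centered_sqint k (X : T -> 'cV[R]_k) V :
  centered_gaussian P X V -> sqint_vec X.
Proof.
move=> [[mX _] EX covX] i; have /measurable_mxP/(_ i 0) mXi := mX.
split=> //; apply/integrableP; split.
  by apply/measurable_EFinP; exact: measurable_funX.
have := covX i i; rewrite covariance.unlock EX expectation.unlock => vE.
rewrite (_ : integral _ _ _ = (V i i)%:E) ?ltry // -vE.
apply: eq_integral => o _ /=; rewrite ger0_norm ?sqr_ge0 //.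
congr EFin; rewrite -[RHS]/((X o i 0 - 0) * (X o i 0 - 0)).
by rewrite subr0 expr2.
Qed.

Lemma centered_integral0 k (X : T -> 'cV[R]_k) V i :
  centered_gaussian P X V -> (\int[P]_o (X o i 0)%:E = 0)%E.
Proof. by move=> [_ EX _]; rewrite -(EX i) expectation.unlock. Qed.

(** The mean E[X; E] is not divided by the probability of [E], so null events need no separate
    treatment. *)
Definition vmean k (E : set T) (X : T -> 'cV[R]_k) : 'cV[R]_k :=
  \col_i \int[P]_(o in E) X o i 0.

Section Mean.
Variables (E : set T) (mE : measurable E).

Let intrE f : intr f -> P.-integrable E (EFin \o f).
Proof. by move=> fi; apply: integrableS fi. Qed.

Lemma Rint_sum I (r : seq I) (F : I -> T -> R) : (forall i, intr (F i)) ->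
  \int[P]_(o in E) (\sum_(i <- r) F i o) = \sum_(i <- r) \int[P]_(o in E) F i o.
Proof.
move=> Fi; elim: r => [|i r IH].
  by under eq_Rintegral do rewrite big_nil; rewrite big_nil Rintegral_cst // mul0r.
under eq_Rintegral do rewrite big_cons; rewrite big_cons RintegralD ?IH //.
  exact: intrE.
exact/intrE/intr_sum.
Qed.

Lemma vmeanD k (X Y : T -> 'cV[R]_k) : intr_vec X -> intr_vec Y ->
  vmean E (fun o => X o + Y o) = vmean E X + vmean E Y.
Proof.
move=> Xi Yi; apply/matrixP => i j; rewrite !mxE.
by under eq_Rintegral do rewrite mxE; rewrite RintegralD //; exact: intrE.
Qed.

Lemma vmean_mulmx k l (M : 'M[R]_(l, k)) (X : T -> 'cV[R]_k) : intr_vec X ->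
  vmean E (fun o => M *m X o) = M *m vmean E X.
Proof.
move=> Xi; apply/matrixP => i j; rewrite !mxE.
under eq_Rintegral do rewrite mxE; rewrite Rint_sum => [|s]; last exact: intrZ.
by apply: eq_bigr => s _; rewrite RintegralZl ?mxE //; exact: intrE.
Qed.

Lemma vmean_bform k (M : 'M[R]_k) (X : T -> 'cV[R]_k) y : intr_vec X ->
  \int[P]_(o in E) bform M (X o) y = bform M (vmean E X) y.
Proof.
move=> Xi; have bE (x : 'cV[R]_k) : bform M x y = (((M *m y)^T) *m x) 0 0.
  by rewrite /bform -mulmxA -[in RHS](trmxK x) -trmx_mul [RHS]mxE.
rewrite bE -vmean_mulmx // mxE.
by apply: eq_Rintegral => o _; rewrite bE.
Qed.

(** The passage from the stochastic to the deterministic problem: against a deterministic direction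
    the cross cost is linear, so its mean is the cross cost of the means. *)
Lemma Rint_cost_form n m (Q : 'M[R]_n) (Ru : 'M[R]_m) (S : 'M[R]_n) N
    (x : nat -> T -> 'cV[R]_n) (u : nat -> T -> 'cV[R]_m)
    (y : nat -> 'cV[R]_n) (e : nat -> 'cV[R]_m) :
  (forall t, (t <= N)%N -> intr_vec (x t)) ->
  (forall t, (t < N)%N -> intr_vec (u t)) ->
  \int[P]_(o in E) cost_form Q Ru S N (x ^~ o) (u ^~ o) y e =
  cost_form Q Ru S N (fun t => vmean E (x t)) (fun t => vmean E (u t)) y e.
Proof.
move=> xi ui.
have bi k (M : 'M[R]_k) X z : intr_vec X -> intr (fun o => bform M (X o) z).
  move=> Xi; under eq_fun do rewrite bform_entries.
  apply: intr_sum => i; apply: intr_sum => j.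
  apply: eq_intr (intrZ (M i j * z j 0) (Xi i)) => o.
  by rewrite -mulrA [z _ _ * _]mulrC.
have si t : (t < N)%N ->
    intr (fun o => bform Q (x t o) (y t) + bform Ru (u t o) (e t)).
  by move=> tN; apply: intrD; apply: bi; [exact: xi (ltnW tN)|exact: ui].
rewrite /cost_form RintegralD //;
  [|apply: intrE|by apply: intrE; apply: bi; exact: xi]; last first.
  by apply: intr_sum => t; exact: si.
rewrite vmean_bform; last exact: xi.
congr (_ + _).
rewrite Rint_sum => [|t]; last exact: si.
apply: eq_bigr => t _; have tN := ltn_ord t.
rewrite RintegralD //; first by rewrite !vmean_bform //; [exact: ui|exact: xi (ltnW tN)].
  by apply: intrE; apply: bi; exact: xi (ltnW tN).
by apply: intrE; apply: bi; exact: ui.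
Qed.

End Mean.

End SquareIntegrable.

(** * Conditional expectations given a random element *)

Section ConditionalExpectation.
Variables (R : realType) (d : measure_display) (T : measurableType d).
Variable P : probability T R.
Variables (d' : measure_display) (U : measurableType d').
Implicit Types (X f g : T -> R) (Y : T -> U).

Lemma sigma_ofP Y E :
  sigma_of Y E <-> exists2 B, measurable B & E = Y @^-1` B.
Proof.
split=> [[B mB <-]|[B mB ->]]; exists B => //; by rewrite setTI.
Qed.

Lemma measurable_preimage Y B :
  measurable_fun setT Y -> measurable B -> measurable (Y @^-1` B).
Proof. by move=> mY mB; rewrite -[X in measurable X]setTI; exact: mY. Qed.

(** Radon-Nikodym is applied on the target [U], to the push-forward of the charge with density [X]
    against the distribution of [Y]. The density is then a function on [U], and the version comes
    already factored through [Y]. *)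
Lemma cond_exp_exists X Y : measurable_fun setT Y -> intr P X ->
  exists2 h : U -> R, measurable_fun setT h &
    is_cond_exp P (sigma_of Y) X (h \o Y).
Proof.
move=> mY iX.
pose Y' : {mfun T >-> U} := HB.pack Y (isMeasurableFun.Build _ _ _ _ Y mY).
have [nu nuE] : exists nu : {charge set U -> \bar R},
    forall B, nu B = (\int[P]_(o in Y @^-1` B) (X o)%:E)%E.
  unshelve eexists (pushforward (induced_charge iX) Y : {charge set U -> \bar R}).
    exact: mY.
  by [].
have dom : nu `<< distribution P Y'.
  apply/null_content_dominatesP => B mB PB0; rewrite nuE.
  apply: null_set_integral => //; first exact: measurable_preimage.
  apply: measurable_funTS; exact: measurable_int iX.
pose D := Radon_Nikodym nu (distribution P Y').
have mD : measurable_fun setT D by exact: measurable_int (Radon_Nikodym_integrable dom).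
have Dfin y : D y \is a fin_num by exact: Radon_Nikodym_fin_num.
have mh : measurable_fun setT (fine \o D) by exact: measurableT_comp.
have DE : EFin \o (fine \o D) = D by apply/funext => y /=; rewrite fineK.
exists (fine \o D) => //.
have iDY : P.-integrable setT (D \o Y).
  apply/integrableP; split; first exact: measurableT_comp.
  have /integrableP[_] := Radon_Nikodym_integrable dom.
  by rewrite ge0_integral_distribution //; exact: measurableT_comp.
split => //.
- by rewrite (_ : _ \o _ = D \o Y) // -DE.
- move=> B mB; apply/sigma_ofP; exists ((fine \o D) @^-1` B) => //.
  by rewrite -[X in measurable X]setTI; exact: mh.
- move=> E /sigma_ofP[B mB ->]; rewrite -nuE (Radon_Nikodym_integral dom mB).
  rewrite [LHS](@integral_pushforward _ _ _ _ _ Y mY) //; last first.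
    by apply: integrableS iDY => //; exact: measurable_preimage.
  by apply: eq_integral => o _ /=; rewrite fineK.
Qed.

Lemma intr_ae_eq f g : measurable_fun setT f -> {ae P, forall o, f o = g o} ->
  intr P g -> intr P f.
Proof.
move=> mf fg /integrableP[mg gi]; apply/integrableP; split.
  exact/measurable_EFinP.
rewrite (@ae_eq_integral _ _ _ P setT (fun o => `|(EFin \o g) o|)%E) //.
- by do 2 apply: measurableT_comp => //.
- exact: measurableT_comp.
- by apply: filterS fg => o fgo _; rewrite /= fgo.
Qed.

Lemma integral_ae_eq_sets f g (D E : set T) :
  measurable D -> measurable E -> measurable_fun setT f -> measurable_fun setT g ->
  {ae P, forall o, f o = g o} -> {ae P, forall o, D o <-> E o} ->
  (\int[P]_(o in D) (f o)%:E = \int[P]_(o in E) (g o)%:E)%E.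
Proof.
move=> mD mE mf mg fg DE; rewrite integral_mkcond [RHS]integral_mkcond.
apply: ae_eq_integral => //.
- by apply/(measurable_restrictT _ mD)/measurable_funTS/measurable_EFinP.
- by apply/(measurable_restrictT _ mE)/measurable_funTS/measurable_EFinP.
apply: filterS2 fg DE => o fgo DEo _; rewrite !patchE fgo.
by rewrite (_ : (o \in D) = (o \in E)) //; apply/idP/idP; rewrite !inE => /DEo.
Qed.

Lemma sigma_of_measurable Y E :
  measurable_fun setT Y -> sigma_of Y E -> measurable E.
Proof. by move=> mY /sigma_ofP[B mB ->]; exact: measurable_preimage. Qed.

(** The event where [g < f] lies in the sigma-algebra of [Y]. There [f - g] is positive with
    integral 0, so the event is null. *)
Lemma sigma_of_ae_le Y f g : measurable_fun setT Y -> intr P f -> intr P g ->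
  (forall B, measurable B -> sigma_of Y (f @^-1` B)) ->
  (forall B, measurable B -> sigma_of Y (g @^-1` B)) ->
  (forall E, sigma_of Y E ->
     (\int[P]_(o in E) (f o)%:E = \int[P]_(o in E) (g o)%:E)%E) ->
  {ae P, forall o, f o <= g o}.
Proof.
move=> mY fi gi mf mg fg; pose E := [set o | g o < f o].
have sE : sigma_of Y E.
  (* The same functions, with the domain equipped with the sigma-algebra of [Y], so that
     measurability of the comparison yields membership in it. *)
  pose f' : g_sigma_algebra_preimageType Y -> R := f.
  pose g' : g_sigma_algebra_preimageType Y -> R := g.
  have mf' : measurable_fun setT f' by move=> _ B mB; rewrite setTI; exact: mf.
  have mg' : measurable_fun setT g' by move=> _ B mB; rewrite setTI; exact: mg.
  have := measurable_fun_ltr mg' mf' measurableT (Y := [set true]) I.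
  by rewrite setTI (_ : _ @^-1` _ = E).
have mE := sigma_of_measurable mY sE.
have fE : P.-integrable E (EFin \o f) by exact: integrableS fi.
have gE : P.-integrable E (EFin \o g) by exact: integrableS gi.
have mfg : measurable_fun E (fun o => (f o)%:E - (g o)%:E)%E.
  by apply: emeasurable_funB; [exact: measurable_int fE|exact: measurable_int gE].
have /(ae_eq_integral_abs P mE mfg) : (\int[P]_(o in E) `|(f o)%:E - (g o)%:E| = 0)%E.
  rewrite (_ : integral _ _ _ = \int[P]_(o in E) ((f o)%:E - (g o)%:E))%E.
    by rewrite integralB_EFin // fg // subee // integrable_fin_num.
  apply: eq_integral => o /[!inE] Eo.
  by rewrite gee0_abs // -EFinB lee_fin subr_ge0 ltW.
apply: filterS => o fgo; rewrite leNgt; apply/negP => Eo.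
have /eqP : f o - g o = 0 by exact: (EFin_inj (fgo Eo)).
rewrite subr_eq0 => /eqP fge.
by move: Eo; rewrite fge ltxx.
Qed.

Lemma sigma_of_ae_eq Y f g : measurable_fun setT Y -> intr P f -> intr P g ->
  (forall B, measurable B -> sigma_of Y (f @^-1` B)) ->
  (forall B, measurable B -> sigma_of Y (g @^-1` B)) ->
  (forall E, sigma_of Y E ->
     (\int[P]_(o in E) (f o)%:E = \int[P]_(o in E) (g o)%:E)%E) ->
  {ae P, forall o, f o = g o}.
Proof.
move=> mY fi gi mf mg fg.
have fleg : {ae P, forall o, f o <= g o} by exact: (sigma_of_ae_le mY).
have glef : {ae P, forall o, g o <= f o}.
  by apply: (sigma_of_ae_le mY) => // E sE; rewrite fg.
by apply: filterS2 fleg glef => o fo go; apply/eqP; rewrite eq_le fo.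
Qed.

Lemma cond_exp_unique Y X f g : measurable_fun setT Y ->
  is_cond_exp P (sigma_of Y) X f -> is_cond_exp P (sigma_of Y) X g ->
  {ae P, forall o, f o = g o}.
Proof.
move=> mY [_ fi mf Xf] [_ gi mg Xg]; apply: (sigma_of_ae_eq mY) => // E sE.
by rewrite -Xf // Xg.
Qed.

(** The sigma-algebras of [Y] and [Y'] can differ by null sets, so the version [h \o Y] itself may
    fail to be measurable for [Y']; composing the same [h] with [Y'] repairs this. *)
Lemma cond_exp_ae_eq Y Y' X X' (h : U -> R) :
  measurable_fun setT Y -> measurable_fun setT Y' -> measurable_fun setT h ->
  measurable_fun setT X' ->
  {ae P, forall o, Y' o = Y o} -> {ae P, forall o, X' o = X o} ->
  is_cond_exp P (sigma_of Y) X (h \o Y) ->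
  is_cond_exp P (sigma_of Y') X' (h \o Y').
Proof.
move=> mY mY' mh mX' YY XX [iX ihY _ Xh].
have mX : measurable_fun setT X 
  by apply/measurable_EFinP; exact: measurable_int iX.
have hY : {ae P, forall o, (h \o Y') o = (h \o Y) o}.
  by apply: filterS YY => o /= ->.
split.
- exact: intr_ae_eq XX iX.
- by apply: intr_ae_eq hY ihY; exact: measurableT_comp.
- move=> B mB; apply/sigma_ofP; exists (h @^-1` B) => //.
  by rewrite -[X in measurable X]setTI; exact: mh.
move=> E /sigma_ofP[B mB ->].
have YB : {ae P, forall o, (Y' @^-1` B) o <-> (Y @^-1` B) o}.
  by apply: filterS YY => o /= ->.
have mYB := measurable_preimage mY mB; have mYB' := measurable_preimage mY' mB.
rewrite (integral_ae_eq_sets mYB' mYB mX' mX XX YB).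
rewrite (integral_ae_eq_sets mYB' mYB _ _ hY YB); try exact: measurableT_comp.
by rewrite Xh //; apply/sigma_ofP; exists B.
Qed.

End ConditionalExpectation.

(** * Means over events of independent noises *)

Section Independence.
Variables (R : realType) (d : measure_display) (T : measurableType d).
Variable P : probability T R.

(** Restricting the probability to [E] and pushing it forward along [X] gives the distribution of
    [X] scaled by the probability of [E]. *)
Lemma indep_event_integral (d' : measure_display) (U : measurableType d')
    (X : T -> U) (E : set T) (f : U -> \bar R) :
  measurable_fun setT X -> measurable E -> measurable_fun setT f ->
  (forall y, 0 <= f y)%E ->
  (forall B, measurable B -> P (E `&` X @^-1` B) = P E * P (X @^-1` B))%E ->
  (\int[P]_(o in E) f (X o) = P E * \int[P]_o f (X o))%E.
Proof.
move=> mX mE mf f0 ind.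
pose X' : {mfun T >-> U} := HB.pack X (isMeasurableFun.Build _ _ _ _ X mX).
have PEfin : P E \is a fin_num by exact: fin_num_measure.
pose c : {nonneg R} := NngNum (fine_ge0 (measure_ge0 P E)).
have cE : c%:num%:E = P E by rewrite /= fineK.
have mfX : measurable_fun setT (f \o X) by exact: measurableT_comp.
have -> : (\int[P]_(o in E) f (X o) = \int[mrestr P mE]_(o in E) f (X o))%E.
  apply: eq_measure_integral => A mA AE; rewrite /mrestr.
  by congr (P _); apply/esym/setIidl.
have -> : (\int[mrestr P mE]_(o in E) f (X o) =
           \int[mrestr P mE]_o f (X o))%E.
  rewrite [RHS](@ge0_negligible_integral _ _ _ _ _ (~` E)) //.
  - by rewrite setDE setCK setTI.
  - exact: measurableC.
  - by rewrite -[LHS]/(P (~` E `&` E)) setICl measure0.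
rewrite -(@ge0_integral_pushforward _ _ _ _ _ X mX (mrestr P mE) setT f) //.
rewrite (@eq_measure_integral _ _ _ _ (mscale c (distribution P X'))); last first.
  move=> B mB _; rewrite -[LHS]/(P (X @^-1` B `&` E)) setIC ind //.
  by rewrite -[RHS]/(c%:num%:E * P (X @^-1` B))%E cE.
by rewrite ge0_integral_mscale // cE ge0_integral_distribution.
Qed.

Lemma indep_event_integral0 (d' : measure_display) (U : measurableType d')
    (X : T -> U) (E : set T) (f : U -> R) :
  measurable_fun setT X -> measurable E -> measurable_fun setT f ->
  intr P (f \o X) -> (\int[P]_o (f (X o))%:E = 0)%E ->
  (forall B, measurable B -> P (E `&` X @^-1` B) = P E * P (X @^-1` B))%E ->
  (\int[P]_(o in E) (f (X o))%:E = 0)%E.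
Proof.
move=> mX mE mf fi f0 ind.
have mEf : measurable_fun setT (EFin \o f) by exact/measurable_EFinP.
have mfp := measurable_funepos mEf; have mfn := measurable_funeneg mEf.
rewrite -[LHS]/(\int[P]_(o in E) ((EFin \o f) \o X) o)%E integralE.
rewrite funepos_comp funeneg_comp /=.
rewrite (indep_event_integral mX mE mfp) // (indep_event_integral mX mE mfn) //.
move: f0; rewrite -[LHS]/(\int[P]_o ((EFin \o f) \o X) o)%E integralE.
rewrite funepos_comp funeneg_comp /=.
have ifp : (\int[P]_o ((EFin \o f)^\+ (X o)) \is a fin_num)%E.
  apply: integrable_fin_num => //; have := integrable_funepos measurableT fi.
  by rewrite -[EFin \o (f \o X)]/((EFin \o f) \o X) funepos_comp.
have ifn : (\int[P]_o ((EFin \o f)^\- (X o)) \is a fin_num)%E.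
  apply: integrable_fin_num => //; have := integrable_funeneg measurableT fi.
  by rewrite -[EFin \o (f \o X)]/((EFin \o f) \o X) funeneg_comp.
have PEfin : P E \is a fin_num by exact: fin_num_measure.
move=> fpn; rewrite -muleBr // ?fpn ?mule0 //.
by rewrite fin_num_adde_defr.
Qed.

Variables (I : finType) (G : I -> set (set T)).
Hypotheses (G_indep : mutually_independent P G).
Hypotheses (GT : forall i, G i setT) (GI : forall i, setI_closed (G i)).
Hypothesis G_measurable : forall i A, G i A -> measurable A.

(** A pi-system generating the joint sigma-algebra of the factors in [J], on which the product
    formula applies directly. *)
Definition cylinder (J : {set I}) : set (set T) :=
  [set A | exists2 E : I -> set T, forall i, i \in J -> G i (E i) &
                                   A = \bigcap_(i in [set` J]) E i].

Lemma cylinder_setI J : setI_closed (cylinder J).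
Proof.
move=> _ _ [E GE ->] [F GF ->]; exists (fun i => E i `&` F i) => [i iJ|].
  by apply: GI; [exact: GE|exact: GF].
by rewrite bigcapI.
Qed.

Lemma cylinder_sub (J : {set I}) i : i \in J -> G i `<=` cylinder J.
Proof.
move=> iJ A GA; exists (fun j => if j == i then A else setT) => [j _|].
  by case: eqP => [->|].
apply/seteqP; split=> [ o Ao j _ /= | o /(_ i iJ)]; last by rewrite eqxx.
by case: eqP.
Qed.

Lemma cylinder_measurable J A : cylinder J A -> measurable A.
Proof.
move=> [E GE ->]; apply: fin_bigcap_measurable => // i /= iJ.
exact/G_measurable/GE.
Qed.

Lemma cylinder_indep (J : {set I}) k A D : k \notin J -> cylinder J A -> G k D ->
  (P (A `&` D) = P A * P D)%E.
Proof.
move=> kJ [E GE ->] GD; rewrite (G_indep GE).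
(* Placing [D] at the new index [k] turns the intersection into one over [k |: J], and the product
   formula is applied a second time. *)
pose F i := if i == k then D else E i.
have FE i : i \in J -> F i = E i.
  by rewrite /F; case: eqP => [->|//]; rewrite (negbTE kJ).
have Fk : F k = D by rewrite /F eqxx.
have GF i : i \in k |: J -> G i (F i).
  by rewrite in_setU1 => /orP[/eqP ->|iJ]; rewrite ?Fk // FE //; exact: GE.
have := G_indep GF; rewrite big_setU1 //= Fk muleC.
rewrite (eq_bigr (fun i => P (E i))) => [<-|i /FE -> //].
congr (P _); apply/seteqP; split=> [ o [Eo Do] i /= |o Fo].
  rewrite in_setU1 => /orP[/eqP ->|iJ]; first by rewrite Fk.
  by rewrite FE //; exact: Eo.
split=> [i /= iJ|]; last by rewrite -Fk; apply: Fo; rewrite /= finset.setU11.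
by have := Fo i; rewrite /= in_setU1 iJ orbT FE //; exact.
Qed.

(** Events over which the integral vanishes form a Dynkin class, the total integral being 0. The
    induction therefore runs on the integrals themselves rather than on independence of the
    generated sigma-algebras. *)
Lemma indep_integral0 (d' : measure_display) (U : measurableType d')
    (J : {set I}) k (X : T -> U) (f : U -> R) A :
  k \notin J -> measurable_fun setT X -> sigma_of X `<=` G k ->
  measurable_fun setT f -> intr P (f \o X) -> (\int[P]_o (f (X o))%:E = 0)%E ->
  <<s cylinder J >> A -> (\int[P]_(o in A) (f (X o))%:E = 0)%E.
Proof.
move=> kJ mX XG mf fi f0.
have mEf : measurable_fun setT (fun o => (f (X o))%:E) by exact: measurable_int fi.
suff : forall A, <<s cylinder J >> A ->
    measurable A /\ (\int[P]_(o in A) (f (X o))%:E = 0)%E.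
  by move=> H /H[].
apply: (@dynkin_induction _ (g_sigma_algebraType (cylinder J)) (cylinder J)) => //.
- exact: cylinder_setI.
- move=> B cB; have mB := cylinder_measurable cB; split => //.
  apply: indep_event_integral0 => // D mD.
  by apply: (cylinder_indep kJ cB); apply: XG; apply/sigma_ofP; exists D.
- move=> B _ [mB B0]; split; first exact: measurableC.
  have := f0; rewrite -[in LHS](setUv B) integral_setU ?setUv //.
  + by rewrite B0 add0e.
  + exact: measurableC.
  + by apply/disj_setPS; rewrite setICr.
- move=> F _ tF HF; have mF n : d.-measurable (F n : set T) := (HF n).1.
  split; first exact: bigcupT_measurable.
  rewrite integral_bigcup //; last first.
    by apply: integrableS fi => //; exact: bigcupT_measurable.
  by rewrite eseries0 // => n _ _; exact: (HF n).2.
Qed.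

End Independence.

(** * Optimal laws *)

Section Optimality.
Variables (R : realType) (d : measure_display) (T : measurableType d).
Variable P : probability T R.
Variables (n m1 m2 p1 p2 N : nat).
Variables (A : 'M[R]_n) (B : 'M[R]_(n, m1 + m2)) (C : 'M[R]_(p1 + p2, n)).
Variables (Q : 'M[R]_n) (Ru : 'M[R]_(m1 + m2)) (S : 'M[R]_n).
Hypotheses (Q_pos : posdefmx Q) (Ru_pos : posdefmx Ru) (S_pos : posdefmx S).
Variables (x0 : T -> 'cV[R]_n) (v : nat -> T -> 'cV[R]_n).
Variable w : nat -> T -> 'cV[R]_(p1 + p2).
Variables (Sigma0 V : 'M[R]_n) (W : 'M[R]_(p1 + p2)).
Hypothesis x0_gauss : centered_gaussian P x0 Sigma0.
Hypothesis v_gauss : forall t, (t < N)%N -> centered_gaussian P (v t) V.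
Hypothesis w_gauss : forall t, (t < N)%N -> centered_gaussian P (w t) W.
Hypothesis indep : independent_noises P N x0 v w.

Local Notation m := (m1 + m2)%N.
Local Notation p := (p1 + p2)%N.
Local Notation law := (law R m1 m2 p1 p2).
Local Notation state := (state A B C x0 v w).
Local Notation past := (past A B C x0 v w).
Local Notation output := (output A B C x0 v w).
Local Notation input := (input A B C x0 v w).
Local Notation traj := (traj A B).
Local Notation control := (@control R d T n m1 m2 p1 p2 N A B C x0 v w).
Local Notation fpast := (@free_past R d T n m1 m2 p1 p2 A B C x0 v w).
Local Notation cost := (cost P N A B C x0 v w Q Ru S).
Local Notation optimal := (optimal P N A B C x0 v w Q Ru S).
Local Notation cost_form := (cost_form Q Ru S N).
Implicit Types g : law.

Let x0_sq : sqint_vec P x0. Proof. exact: centered_sqint x0_gauss. Qed.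

Let v_sq t : (t < N)%N -> sqint_vec P (v t).
Proof. by move=> tN; apply: centered_sqint; exact: v_gauss. Qed.

Let w_sq t : (t < N)%N -> sqint_vec P (w t).
Proof. by move=> tN; apply: centered_sqint; exact: w_gauss. Qed.

Let mx0 : measurable_fun setT x0. Proof. by case: x0_gauss => -[]. Qed.

Let mv t : (t < N)%N -> measurable_fun setT (v t).
Proof. by move=> /v_gauss[[]]. Qed.

Let mw t : (t < N)%N -> measurable_fun setT (w t).
Proof. by move=> /w_gauss[[]]. Qed.

Lemma measurable_past g t : admissible N g -> (t <= N)%N ->
  measurable_fun setT (past g t).
Proof.
move=> gadm tN; rewrite (_ : past g t = @replay _ _ _ _ _ _ A B C g t \o fpast t).
  apply: measurableT_comp; first exact: measurable_replay gadm tN.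
  apply: measurable_free_past => // s st; first exact: mv (leq_trans st tN).
  exact: mw (leq_trans st tN).
by apply/funext => o; rewrite replayE.
Qed.

(* Hence the noises still to come are independent of the past, whatever the law. *)
Lemma past_event g t E : admissible N g -> (t <= N)%N ->
  sigma_of (past g t) E ->
  exists2 D, measurable D & E = fpast t @^-1` D.
Proof.
move=> gadm tN /sigma_ofP[D mD ->].
exists (@replay _ _ _ _ _ _ A B C g t @^-1` D).
  exact: measurable_preimage (measurable_replay A B C gadm tN) mD.
by rewrite -comp_preimage; congr (_ @^-1` D); apply/funext => o; rewrite replayE.
Qed.

Let G (i : option ('I_N + 'I_N)) : set (set T) := match i with
  | None => sigma_of x0
  | Some (inl t) => sigma_of (v t)
  | Some (inr t) => sigma_of (w t)
  end.

Let sigma_ofT d' (U : measurableType d') (X : T -> U) : sigma_of X setT.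
Proof. by apply/sigma_ofP; exists setT => //; rewrite preimage_setT. Qed.

Let sigma_ofI d' (U : measurableType d') (X : T -> U) : setI_closed (sigma_of X).
Proof.
move=> _ _ /sigma_ofP[D mD ->] /sigma_ofP[E mE ->]; apply/sigma_ofP.
by exists (D `&` E); rewrite ?preimage_setI //; exact: measurableI.
Qed.

Let before t : {set option ('I_N + 'I_N)} := [set i : option ('I_N + 'I_N) |
  match i with None => true | Some (inl s) => s < t | Some (inr s) => s < t end]%N%SET.

Lemma noise_mean0 k (Z : T -> 'cV[R]_k) M t D i :
  i \notin before t -> G i = sigma_of Z -> centered_gaussian P Z M ->
  (t <= N)%N -> measurable D -> vmean P (fpast t @^-1` D) Z = 0.
Proof.
move=> it GZ Zg tN mD; have [[mZ _] _ _] := Zg.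
have GT j : G j setT by case: j => [[]|]; move=> *; exact: sigma_ofT.
have GI j : setI_closed (G j) by case: j => [[]|]; move=> *; exact: sigma_ofI.
have GM j E : G j E -> measurable E.
  case: j => [[s|s]|]; apply: sigma_of_measurable => //.
    exact: mv (ltn_ord s).
  exact: mw (ltn_ord s).
apply/matrixP => r c; rewrite !mxE.
(* [T'] is the sample space with the sigma-algebra of the sources before [t]. [measurable_free_past]
   holds over any measurable space, and over [T'] it says that the event is generated by these
   sources. *)
pose T' := g_sigma_algebraType (cylinder G (before t)).
have genE d' (U : measurableType d') (X : T -> U) j :
    j \in before t -> G j = sigma_of X -> measurable_fun setT (X : T' -> U).
  move=> jt GX _ Y mY; rewrite setTI; apply: sub_sigma_algebra.
  by apply: (cylinder_sub GT jt); rewrite GX; apply/sigma_ofP; exists Y.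
have fpD : <<s cylinder G (before t) >> (fpast t @^-1` D).
  have mfp : measurable_fun setT
      (@free_past R _ T' n m1 m2 p1 p2 A B C x0 v w t).
    apply: measurable_free_past => [|s st|s st].
    - by apply: (genE _ _ _ None); rewrite // inE.
    - have sN := leq_trans st tN.
      by apply: (genE _ _ _ (Some (inl (Ordinal sN)))); rewrite // inE.
    - have sN := leq_trans st tN.
      by apply: (genE _ _ _ (Some (inr (Ordinal sN)))); rewrite // inE.
  by have := mfp measurableT D mD; rewrite setTI.
have /measurable_mxP/(_ r 0) mr :
  measurable_fun setT (fun z : 'cV[R]_k => z) by [].
have /(congr1 fine) : (\int[P]_(o in fpast t @^-1` D) (Z o r 0)%:E = 0)%E.
  apply: (indep_integral0 indep GI GM it mZ _ mr _ _ fpD).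
  - by move=> E; rewrite -GZ.
  - exact: sqint_intr (centered_sqint Zg r).
  - exact: centered_integral0 Zg.
by [].
Qed.

Lemma v_mean0 t s D : (t <= s < N)%N -> measurable D ->
  vmean P (fpast t @^-1` D) (v s) = 0.
Proof.
move=> /andP[ts sN] mD.
apply: (@noise_mean0 _ _ V t D (Some (inl (Ordinal sN)))) => //.
- by rewrite inE -leqNgt.
- exact: v_gauss.
- exact: leq_trans ts (ltnW sN).
Qed.

Lemma w_mean0 t D : (t < N)%N -> measurable D ->
  vmean P (fpast t @^-1` D) (w t) = 0.
Proof.
move=> tN mD; apply: (@noise_mean0 _ _ W t D (Some (inr (Ordinal tN)))) => //.
- by rewrite inE ltnn.
- exact: w_gauss.
- exact: ltnW.
Qed.

Lemma state_traj g t :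
  state g t = fun o => traj (x0 o) (input g ^~ o) (v ^~ o) t.
Proof. by apply/funext => o; rewrite stateE. Qed.

Lemma measurable_input g t : admissible N g -> (t < N)%N ->
  measurable_fun setT (input g t).
Proof.
move=> gadm; elim/ltn_ind: t => t IH tN; apply: (measurable_apply_law gadm tN).
  exact: measurable_past gadm (ltnW tN).
apply: measurable_addmx; last exact: mw.
apply: measurable_mulmx; rewrite state_traj.
apply: measurable_traj => // s st; first exact: IH (ltn_trans st tN).
exact: mv (ltn_trans st tN).
Qed.

Lemma measurable_state g t : admissible N g -> (t <= N)%N ->
  measurable_fun setT (state g t).
Proof.
move=> gadm tN; rewrite state_traj.
apply: measurable_traj => // s st; first exact: measurable_input (leq_trans st tN).
exact: mv (leq_trans st tN).
Qed.

Definition path_cost g o := cost_form (state g ^~ o) (input g ^~ o)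
                                      (state g ^~ o) (input g ^~ o).

Lemma costE g : cost g = (\int[P]_o (path_cost g o)%:E)%E.
Proof. by rewrite /Defs.cost expectation.unlock. Qed.

Lemma measurable_bform k (M : 'M[R]_k) (X Y : T -> 'cV[R]_k) :
  measurable_fun setT X -> measurable_fun setT Y ->
  measurable_fun setT (fun o => bform M (X o) (Y o)).
Proof.
move=> /measurable_mxP mX /measurable_mxP mY.
under eq_fun do rewrite bform_entries.
do 2 apply: measurable_sum => ?; apply: measurable_funM => //.
exact: measurable_funM.
Qed.

Lemma measurable_path_cost g : admissible N g -> measurable_fun setT (path_cost g).
Proof.
move=> gadm; apply: measurable_funD; last first.
  by apply: measurable_bform; exact: measurable_state.
apply: measurable_sum => t; have tN := ltn_ord t.
apply: measurable_funD; apply: measurable_bform.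
- exact: measurable_state (ltnW tN).
- exact: measurable_state (ltnW tN).
- exact: measurable_input.
- exact: measurable_input.
Qed.

Lemma finite_cost_sqint g t : admissible N g -> (cost g < +oo)%E ->
  (t < N)%N -> sqint_vec P (input g t).
Proof.
move=> gadm gfin tN; have mu := measurable_input gadm tN.
have ic : intr P (path_cost g).
  apply/integrableP; split; first exact/measurable_EFinP/measurable_path_cost.
  rewrite (_ : integral _ _ _ = cost g) // costE; apply: eq_integral => o _.
  by rewrite gee0_abs // lee_fin; exact: cost_form_ge0.
have [c c0 cq] := sqr_entry_le_qform Ru_pos.
move=> i; have /measurable_mxP/(_ i 0) mui := mu; split=> //.
apply: le_intr (intrZ (c i) ic) => [|o]; first exact: measurable_funX.
rewrite ger0_norm ?sqr_ge0 // (le_trans (cq i _)) // ler_wpM2l //.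
exact: (qform_input_le_cost Q_pos Ru_pos S_pos).
Qed.

Lemma sqint_state g t : (forall s, (s < N)%N -> sqint_vec P (input g s)) ->
  (t <= N)%N -> sqint_vec P (state g t).
Proof.
move=> us tN; rewrite state_traj; apply: sqint_traj => // s st.
  exact: us (leq_trans st tN).
exact: v_sq (leq_trans st tN).
Qed.

Lemma pulse_sqint s t (D : set 'M[R]_(p, t)) (e : nat -> 'cV[R]_m) : (t <= N)%N ->
  measurable D -> sqint_vec P (fun o => \1_(fpast t @^-1` D) o *: e s).
Proof.
move=> tN mD; apply: sqint_pulse; apply: measurable_preimage => //.
apply: measurable_free_past => // r rt; first exact: mv (leq_trans rt tN).
exact: mw (leq_trans rt tN).
Qed.

Lemma intr_path_cost g : (forall s, (s < N)%N -> sqint_vec P (input g s)) ->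
  intr P (path_cost g).
Proof.
by move=> us; apply: intr_cost_form => t tN; [exact: sqint_state|exact: us|
  exact: sqint_state|exact: us].
Qed.

(** Costs are extended reals, so an optimum must first be shown to have finite cost; the competitor
    is the zero control, obtained as a pulse of height 0. *)
Lemma optimal_sqint g t : optimal g -> (t < N)%N -> sqint_vec P (input g t).
Proof.
move=> [gadm gopt] tN; apply: finite_cost_sqint => //.
have /control_realized[h hadm hE] :=
  @control_pulse R d T n m1 m2 p1 p2 N A B C x0 v w 0 setT (fun=> 0)
    measurableT (fun _ _ => erefl).
apply: le_lt_trans (gopt h hadm) _; rewrite costE.
apply: integrable_lty => //; apply: intr_path_cost => s sN.
rewrite (_ : input h s = fun o => \1_(fpast 0 @^-1` setT) o *: 0).
  exact: (@pulse_sqint s 0 setT (fun=> 0)).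
by apply/funext => o; rewrite hE.
Qed.

(** * First and second variations of the cost *)

Section Variation.
Variables (g : law) (u : nat -> T -> 'cV[R]_m).
Hypothesis g_adm : admissible N g.
Hypothesis g_sq : forall t, (t < N)%N -> sqint_vec P (input g t).
Hypothesis u_control : control u.
Hypothesis u_sq : forall t, (t < N)%N -> sqint_vec P (u t).

Definition response t o := traj 0 (u ^~ o) (fun=> 0) t.

Lemma sqint_response t : (t <= N)%N -> sqint_vec P (response t).
Proof.
move=> tN; apply: (@sqint_traj _ _ _ P _ _ A B (fun=> 0) u (fun _ _ => 0)) =>
  [|s st|s st].
- by move=> i; under eq_fun do rewrite mxE; exact: sqint_cst.
- exact: u_sq (leq_trans st tN).
- by move=> i; under eq_fun do rewrite mxE; exact: sqint_cst.
Qed.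

Let cross o := cost_form (state g ^~ o) (input g ^~ o) (response ^~ o) (u ^~ o).
Let second o := cost_form (response ^~ o) (u ^~ o) (response ^~ o) (u ^~ o).

Let cross_intr : intr P cross.
Proof.
by apply: intr_cost_form => t tN; [exact: sqint_state|exact: g_sq|
  exact: sqint_response|exact: u_sq].
Qed.

Let second_intr : intr P second.
Proof.
by apply: intr_cost_form => t tN; [exact: sqint_response|exact: u_sq|
  exact: sqint_response|exact: u_sq].
Qed.

Lemma cost_perturbed (h : law) e :
  (forall t o, input h t o = input g t o + e *: u t o) ->
  cost h = (\int[P]_o path_cost g o + 2 * e * \int[P]_o cross o
            + e ^+ 2 * \int[P]_o second o)%:E.
Proof.
move=> hE; have stE t o : state h t o = state g t o + e *: response t o.
  rewrite !stateE /response -traj_pulse -trajD addr0.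
  by apply: eq_traj => s _; rewrite ?hE ?addr0.
have gi := intr_path_cost g_sq.
rewrite costE -RintegralZl // -RintegralZl // -RintegralD //; last exact: intrZ.
rewrite -RintegralD //; [|exact: intrD (intrZ _ _)|exact: intrZ].
rewrite /Rintegral fineK; last first.
  apply: integrable_fin_num => //; apply: intrD; last exact: intrZ.
  by apply: intrD => //; exact: intrZ.
apply: eq_integral => o _; congr EFin; rewrite -cost_form_perturb //.
by apply: eq_cost_form => t _; rewrite ?stE ?hE.
Qed.

Lemma variation_law e : exists2 h : law, admissible N h &
  forall t o, input h t o = input g t o + e *: u t o.
Proof.
have gc := @input_control R d T n m1 m2 p1 p2 N A B C x0 v w g g_adm.
exact: control_realized (control_perturb e gc u_control).
Qed.

Lemma first_variation : optimal g -> \int[P]_o cross o = 0.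
Proof.
move=> [_ gopt]; set b := \int[P]_o cross o; set c := \int[P]_o second o.
have c0 : 0 <= c by apply: Rintegral_ge0 => o _; exact: cost_form_ge0.
have le0 e : 0 <= 2 * e * b + e ^+ 2 * c.
  have [h hadm hE] := variation_law e.
  have := gopt h hadm; rewrite (cost_perturbed hE) (@cost_perturbed g 0).
    by rewrite lee_fin mulr0 !mul0r expr0n mul0r !addr0 -addrA lerDl.
  by move=> t o; rewrite scale0r addr0.
have k0 : 0 < c + 1 by rewrite ltr_wpDl.
(* The minimiser would be [- b / c], but [c] may be 0. With [c + 1] the value is
   [- b ^+ 2 * (c + 2) / (c + 1) ^+ 2], whose sign forces [b = 0]. *)
have := le0 (- b / (c + 1)); rewrite -(pmulr_rge0 _ (exprn_gt0 2 k0)).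
have -> : (c + 1) ^+ 2 * (2 * (- b / (c + 1)) * b + (- b / (c + 1)) ^+ 2 * c) =
          - (b ^+ 2 * (c + 2)).
  by field; rewrite gt_eqF.
rewrite oppr_ge0 pmulr_lle0 ?ltr_wpDl // => b2.
by apply/eqP; rewrite -sqrf_eq0 eq_le b2 sqr_ge0.
Qed.

Lemma second_variation_ae0 : \int[P]_o second o = 0 ->
  forall t, (t < N)%N -> {ae P, forall o, u t o = 0}.
Proof.
move=> s0 t tN; have s_ge0 o : 0 <= second o by exact: cost_form_ge0.
have ms : measurable_fun setT (EFin \o second) by exact: measurable_int second_intr.
have /(ae_eq_integral_abs P measurableT ms) : (\int[P]_o `|(EFin \o second) o| = 0)%E.
  rewrite -[RHS]/(0%:E) -s0 /Rintegral fineK; last exact: integrable_fin_num.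
  by apply: eq_integral => o _; rewrite gee0_abs // lee_fin.
apply: filterS => o so; have so0 : second o = 0 by exact: (EFin_inj (so I)).
apply: (posdef_qform_eq0 Ru_pos); apply/eqP; rewrite eq_le posdef_qform_ge0 // andbT.
by rewrite -so0; exact: (qform_input_le_cost Q_pos Ru_pos S_pos _ (u ^~ o)).
Qed.

End Variation.

(* The cost is a strictly convex quadratic function of the control. *)
Lemma optimal_input_unique g h t : optimal g -> optimal h -> (t < N)%N ->
  {ae P, forall o, input g t o = input h t o}.
Proof.
move=> go ho tN; have [gadm gopt] := go; have [hadm hopt] := ho.
have gs s (sN : (s < N)%N) := optimal_sqint go sN.
have hs s (sN : (s < N)%N) := optimal_sqint ho sN.
pose u s o := input g s o + (-1) *: input h s o.
have uc : control u by apply: control_perturb; exact: input_control.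
have us s : (s < N)%N -> sqint_vec P (u s).
  move=> sN; apply: sqint_addmx; first exact: gs.
  by apply: sqint_scalemx; exact: hs.
(* Expanding around [h] with step 1, the first-order term vanishes and the cost of [g] exceeds that
   of [h] by exactly the second-order term, which optimality of [g] makes nonpositive. *)
have gE s o : input g s o = input h s o + 1 *: u s o.
  by rewrite /u scale1r scaleN1r addrCA subrr addr0.
have b0 := first_variation hadm hs uc us ho.
have hi := intr_path_cost hs.
have chE : cost h = (\int[P]_o path_cost h o)%:E.
  by rewrite costE /Rintegral fineK // integrable_fin_num.
have := gopt h hadm; rewrite (cost_perturbed hs us gE) b0 mulr0 addr0 expr1n mul1r.
rewrite chE lee_fin gerDl => c_le0.
have c0 : \int[P]_o cost_form (response u ^~ o) (u ^~ o) (response u ^~ o) (u ^~ o) = 0.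
  apply/eqP; rewrite eq_le c_le0 /=.
  by apply: Rintegral_ge0 => o _; exact: cost_form_ge0.
apply: filterS (second_variation_ae0 us c0 tN) => o u0.
by rewrite gE u0 scaler0 addr0.
Qed.

Lemma optimal_mean g t E : optimal g -> (t < N)%N -> sigma_of (past g t) E ->
  vmean P E (input g t) = - (lqr_gain A B Q Ru S N t *m vmean P E (state g t)).
Proof.
move=> go tN sE; have [gadm _] := go.
have mE := sigma_of_measurable (measurable_past gadm (ltnW tN)) sE.
have [D mD ED] := past_event gadm (ltnW tN) sE.
have us s (sN : (s < N)%N) := optimal_sqint go sN.
have xs s (sN : (s <= N)%N) := sqint_state us sN.
apply: (lqr_stationary Q_pos Ru_pos S_pos tN
  (x := fun s => vmean P E (state g s)) (u := fun s => vmean P E (input g s))).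
  move=> s /andP[ts sN].
  rewrite (_ : state g s.+1 = fun o => A *m state g s o + B *m input g s o + v s o);
    last by apply/funext => o; exact: (closed_loopS A B C x0 v w g s o).1.
  have xi := sqint_intr_vec (xs s (ltnW sN)); have ui := sqint_intr_vec (us s sN).
  have Ax := sqint_intr_vec (sqint_mulmx A (xs s (ltnW sN))).
  have Bu := sqint_intr_vec (sqint_mulmx B (us s sN)).
  rewrite vmeanD //; last exact: sqint_intr_vec (v_sq sN).
    rewrite vmeanD // !vmean_mulmx // ED v_mean0 ?addr0 //.
    by rewrite ts.
  apply: sqint_intr_vec; apply: sqint_addmx; apply: sqint_mulmx.
    exact: xs (ltnW sN).
  exact: us.
move=> e e0; pose y := traj 0 e (fun=> 0).
have := first_variation gadm us
  (control_pulse N A B C x0 v w mD e0) (fun s _ => pulse_sqint s e (ltnW tN) mD) go.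
rewrite -Rint_cost_form //;
  [|by move=> s /xs/sqint_intr_vec|by move=> s /us/sqint_intr_vec].
rewrite -ED => fv; apply: etrans fv; rewrite Rintegral_mkcond.
apply: eq_Rintegral => o _.
(* The indicator factors out of the perturbation at each outcome, leaving the deterministic
   direction [y], [e] integrated over [E]. Symmetry moves it to the side where linearity was
   stated. *)
have -> : cost_form (state g ^~ o) (input g ^~ o)
    (response (fun s o => \1_E o *: e s) ^~ o) (fun s => \1_E o *: e s) =
    \1_E o * cost_form (state g ^~ o) (input g ^~ o) y e.
  rewrite (cost_form_sym Q_pos Ru_pos S_pos) [in RHS](cost_form_sym Q_pos Ru_pos S_pos).
  by rewrite -cost_form_Zl; apply: eq_cost_form => s _ //; rewrite /response traj_pulse.
by rewrite patchE indicE; case: (o \in E); rewrite ?mul1r ?mul0r.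
Qed.

(* Comparing means over the events of the past identifies the part of the input
   that depends on the past only. *)
Lemma past_part_gain g t (F : 'M[R]_(m, p)) (L : history R p m t -> 'cV[R]_m)
    (xh : T -> 'cV[R]_n) :
  optimal g -> (t < N)%N -> measurable_fun setT L ->
  {ae P, forall o, input g t o = F *m output g t o + L (past g t o)} ->
  is_cond_exp_vec P (sigma_of (past g t)) (state g t) xh ->
  {ae P, forall o,
    L (past g t o) = - (F *m C + lqr_gain A B Q Ru S N t) *m xh o}.
Proof.
move=> go tN mL uE ce; have [gadm _] := go.
set K := - (F *m C + lqr_gain A B Q Ru S N t).
have mpast := measurable_past gadm (ltnW tN).
have us s (sN : (s < N)%N) := optimal_sqint go sN.
have xs := sqint_state us (ltnW tN); have ws := w_sq tN.
have ys : sqint_vec P (output g t) by apply: sqint_addmx => //; exact: sqint_mulmx.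
(* [L] is only assumed measurable; integrability of [L] along the past comes from its almost sure
   equality with this square-integrable difference. *)
have ls : sqint_vec P (fun o => input g t o + (- F) *m output g t o).
  by apply: sqint_addmx; [exact: us|exact: sqint_mulmx].
have LE : {ae P, forall o,
    L (past g t o) = input g t o + (- F) *m output g t o}.
  by apply: filterS uE => o ->; rewrite mulNmx addrC addKr.
have mLp : measurable_fun setT (L \o past g t) by exact: measurableT_comp.
have xhi : intr_vec P xh by move=> i; have [] := ce i.
have Kxi : intr_vec P (fun o => K *m xh o).
  move=> i; under eq_fun do rewrite mxE.
  by apply: intr_sum => j; apply: intrZ; exact: xhi.
have Li : intr_vec P (L \o past g t).
  move=> i; apply: (intr_ae_eq (g := fun o => (input g t o + (- F) *m output g t o) i 0)).
  - by have /measurable_mxP/(_ i 0) := mLp.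
  - by apply: filterS LE => o /= ->.
  - exact: sqint_intr_vec.
have means E : sigma_of (past g t) E ->
    vmean P E (L \o past g t) = vmean P E (fun o => K *m xh o).
  move=> sE; have mE := sigma_of_measurable mpast sE.
  have [D mD ED] := past_event gadm (ltnW tN) sE.
  have xhE : vmean P E xh = vmean P E (state g t).
    apply/matrixP => i j; rewrite !mxE /Rintegral.
    by have [_ _ _ ->] := ce i.
  transitivity (vmean P E (fun o => input g t o + (- F) *m output g t o)).
    apply/matrixP => i j; rewrite !mxE /Rintegral; congr fine.
    apply: integral_ae_eq_sets => //.
    - by have /measurable_mxP/(_ i 0) := mLp.
    - exact: (ls i).1.
    - by apply: filterS LE => o /= ->.
    - exact: aeW.
  have xi := sqint_intr_vec xs; have ui := sqint_intr_vec (us t tN).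
  have Cxi := sqint_intr_vec (sqint_mulmx C xs).
  have yi := sqint_intr_vec ys; have wi := sqint_intr_vec ws.
  have Fyi := sqint_intr_vec (sqint_mulmx (- F) ys).
  rewrite vmeanD // !vmean_mulmx // xhE (optimal_mean go tN sE).
  rewrite (_ : vmean P E (output g t) = C *m vmean P E (state g t)); last first.
    by rewrite vmeanD // vmean_mulmx // {2}ED w_mean0 // addr0.
  by rewrite /K opprD mulmxDl !mulNmx mulmxA addrC.
(* Retyping the domain with the sigma-algebra of the past keeps linear images of [xh] measurable for
   it. *)
have mxh : measurable_fun setT (xh : g_sigma_algebra_preimageType (past g t) -> _).
  apply/measurable_mxP => i j; rewrite (ord1 j) => _ Y mY; rewrite setTI.
  by have [_ _ mxi _] := ce i; exact: mxi.
have ae_i i : {ae P, forall o, L (past g t o) i 0 = (K *m xh o) i 0}.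
  apply: (sigma_of_ae_eq mpast (Li i) (Kxi i)) => [Y mY|Y mY|E sE].
  - apply/sigma_ofP; exists ((fun h => L h i 0) @^-1` Y) => //.
    rewrite -[X in measurable X]setTI.
    by have /measurable_mxP/(_ i 0) := mL; exact.
  - have /measurable_mxP/(_ i 0) mK := measurable_mulmx K mxh.
    by have := mK measurableT Y mY; rewrite setTI.
  - have mE := sigma_of_measurable mpast sE.
    have fin f : intr P f -> (\int[P]_(o in E) (f o)%:E \is a fin_num)%E.
      by move=> fi; apply: integrable_fin_num => //; exact: integrableS fi.
    have /matrixP/(_ i 0) := means E sE; rewrite !mxE => meansE.
    rewrite -[LHS]fineK; last exact: fin (Li i).
    rewrite -[RHS]fineK; last exact: fin (Kxi i).
    by congr EFin.
have : {ae P, forall o, forall i, L (past g t o) i 0 = (K *m xh o) i 0}.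
  exact: filter_forall.
by apply: filterS => o Lo; apply/matrixP => i j; rewrite (ord1 j).
Qed.

Lemma state_cond_exp g t : admissible N g ->
  (forall s, (s < N)%N -> sqint_vec P (input g s)) -> (t < N)%N ->
  exists2 h : history R p m t -> 'cV[R]_n, measurable_fun setT h &
    is_cond_exp_vec P (sigma_of (past g t)) (state g t) (h \o past g t).
Proof.
move=> gadm us tN; have mpast := measurable_past gadm (ltnW tN).
have xi := sqint_intr_vec (sqint_state us (ltnW tN)).
have /choice[h hE] : forall i, exists h : history R p m t -> R,
    measurable_fun setT h /\
    is_cond_exp P (sigma_of (past g t)) (fun o => state g t o i 0) (h \o past g t).
  by move=> i; have [h mh ch] := cond_exp_exists mpast (xi i); exists h.
exists (fun z => \col_i h i z).
  apply/measurable_mxP => i j; under eq_fun do rewrite mxE; exact: (hE i).1.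
move=> i; have -> : (fun o => (((fun z => \col_j h j z) \o past g t) o : 'cV_n) i 0) =
    h i \o past g t by apply/funext => o; rewrite /= mxE.
exact: (hE i).2.
Qed.

Lemma ae_forall_lt (Z : nat -> T -> Prop) t :
  (forall s, (s < t)%N -> {ae P, forall o, Z s o}) ->
  {ae P, forall o, forall s, (s < t)%N -> Z s o}.
Proof.
move=> HZ; apply/ae_foralln => s; have [st|_] := ltnP s t; last exact: aeW.
by apply: filterS (HZ s st).
Qed.

(** State and output at [t] depend on the law through inputs before [t] only; this drives the
    induction on time. *)
Lemma agree_ae g h t :
  (forall s, (s < t)%N -> {ae P, forall o, input g s o = input h s o}) ->
  [/\ {ae P, forall o, state g t o = state h t o},
      {ae P, forall o, output g t o = output h t o} &
      {ae P, forall o, past g t o = past h t o}].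
Proof.
move=> /ae_forall_lt gh.
have stE o s : (s <= t)%N -> (forall s, (s < t)%N -> input g s o = input h s o) ->
    state g s o = state h s o.
  move=> st uE; rewrite !stateE; apply: eq_traj => // r rs.
  by rewrite uE // (leq_trans rs st).
split; apply: filterS gh => o gho; rewrite ?(stE o t) //.
  by rewrite /Defs.output stE.
rewrite !pastE; congr pair; apply: eq_cols => s st; last exact: gho.
by rewrite /Defs.output stE // ltnW.
Qed.

Lemma agree_cost g h : admissible N g -> admissible N h ->
  (forall s, (s < N)%N -> {ae P, forall o, input g s o = input h s o}) ->
  cost g = cost h.
Proof.
move=> gadm hadm gh; rewrite !costE; apply: ae_eq_integral => //.
- exact/measurable_EFinP/measurable_path_cost.
- exact/measurable_EFinP/measurable_path_cost.
have agree : {ae P, forall o, forall s, (s < N)%N -> input g s o = input h s o}.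
  exact: ae_forall_lt.
apply: filterS agree => o gho _; congr EFin.
have stE s : (s <= N)%N -> state g s o = state h s o.
  move=> sN; rewrite !stateE; apply: eq_traj => // r rs.
  by rewrite gho // (leq_trans rs sN).
exact: eq_cost_form.
Qed.

End Optimality.

Section LinearLaw.
Variables (R : realType) (m1 m2 p1 p2 N : nat).
Variables (F11 : nat -> 'M[R]_(m1, p1)) (F12 : nat -> 'M[R]_(m1, p2)).
Variable F22 : nat -> 'M[R]_(m2, p2).
Variable L1 : forall t, {linear history R (p1 + p2) (m1 + m2) t -> 'cV[R]_m1}.
Variable L2 : forall t, {linear history R (p1 + p2) (m1 + m2) t -> 'cV[R]_m2}.

Definition past_part t (h : history R (p1 + p2) (m1 + m2) t) : 'cV[R]_(m1 + m2) :=
  col_mx (L1 t h) (L2 t h).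

Lemma apply_linear_law t (h : history R (p1 + p2) (m1 + m2) t) y :
  apply_law (linear_law F11 F12 F22 L1 L2) h y =
  block_mx (F11 t) (F12 t) 0 (F22 t) *m y + past_part h.
Proof.
rewrite /past_part /apply_law /=.
by rewrite -[in RHS](vsubmxK y) mul_block_col mul0mx add0r add_col_mx.
Qed.

(** The history part is the law evaluated at the output 0, so its measurability is inherited from
    admissibility. *)
Lemma measurable_past_part t :
  admissible N (linear_law F11 F12 F22 L1 L2) -> (t < N)%N ->
  measurable_fun setT (@past_part t).
Proof.
move=> ladm tN; have mlaw := measurable_apply_law ladm tN
  (@measurable_id _ (history R (p1 + p2) (m1 + m2) t) setT)
  (measurable_cst (0 : 'cV[R]_(p1 + p2))).
congr (measurable_fun _ _): mlaw; apply/funext => h.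
by rewrite apply_linear_law mulmx0 add0r.
Qed.

End LinearLaw.

Theorem theorem5 (R : realType) (d : measure_display) (T : measurableType d)
  (P : probability T R) (n m1 m2 p1 p2 N : nat)
  (A : 'M[R]_n) (B : 'M[R]_(n, m1 + m2)) (C : 'M[R]_(p1 + p2, n))
  (Q : 'M[R]_n) (Ru : 'M[R]_(m1 + m2)) (S : 'M[R]_n)
  (Q_pos : posdefmx Q) (Ru_pos : posdefmx Ru) (S_pos : posdefmx S)
  (x0 : T -> 'cV[R]_n) (v : nat -> T -> 'cV[R]_n)
  (w : nat -> T -> 'cV[R]_(p1 + p2))
  (Sigma0 V : 'M[R]_n) (W : 'M[R]_(p1 + p2))
  (x0_gauss : centered_gaussian P x0 Sigma0)
  (v_gauss : forall t, (t < N)%N -> centered_gaussian P (v t) V)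
  (w_gauss : forall t, (t < N)%N -> centered_gaussian P (w t) W)
  (indep : independent_noises P N x0 v w)
  (F11 : nat -> 'M[R]_(m1, p1)) (F12 : nat -> 'M[R]_(m1, p2))
  (F22 : nat -> 'M[R]_(m2, p2))
  (L1 : forall t, {linear history R (p1 + p2) (m1 + m2) t -> 'cV[R]_m1})
  (L2 : forall t, {linear history R (p1 + p2) (m1 + m2) t -> 'cV[R]_m2})
  (F_opt : optimal P N A B C x0 v w Q Ru S (linear_law F11 F12 F22 L1 L2)) :
  let F t := block_mx (F11 t) (F12 t) 0 (F22 t) in
  let H t := lqr_gain A B Q Ru S N t in
  let G t := - (F t *m C + H t) in
  forall g : law R m1 m2 p1 p2, admissible N g ->
    optimal P N A B C x0 v w Q Ru S g <->
    exists xhat : nat -> T -> 'cV[R]_n,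
      forall t, (t < N)%N ->
        is_cond_exp_vec P (sigma_of (past A B C x0 v w g t))
          (state A B C x0 v w g t) (xhat t) /\
        {ae P, forall o, input A B C x0 v w g t o =
                         F t *m output A B C x0 v w g t o + G t *m xhat t o}.
Proof.
move=> F H G g gadm; set lin := linear_law F11 F12 F22 L1 L2 in F_opt.
pose L t := @past_part R m1 m2 p1 p2 L1 L2 t.
have ladm : admissible N lin by case: F_opt.
have mL t : (t < N)%N -> measurable_fun setT (L t).
  exact: measurable_past_part ladm.
have linE t o : input A B C x0 v w lin t o =
    F t *m output A B C x0 v w lin t o + L t (past A B C x0 v w lin t o).
  exact: apply_linear_law.
have lin_sq := optimal_sqint Q_pos Ru_pos S_pos x0_gauss v_gauss w_gauss F_opt.
split=> [g_opt|[xhat xhatE]].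
  have g_sq := optimal_sqint Q_pos Ru_pos S_pos x0_gauss v_gauss w_gauss g_opt.
  have gl t (tN : (t < N)%N) :=
    optimal_input_unique Q_pos Ru_pos S_pos x0_gauss v_gauss w_gauss g_opt F_opt tN.
  have /choice[xhat xhatE] : forall t, exists xh : T -> 'cV[R]_n, (t < N)%N ->
      is_cond_exp_vec P (sigma_of (past A B C x0 v w g t)) (state A B C x0 v w g t) xh.
    move=> t; have [tN|_] := ltnP t N; last by exists (fun=> 0).
    have [h _ ch] := state_cond_exp x0_gauss v_gauss w_gauss gadm g_sq tN.
    by exists (h \o past A B C x0 v w g t).
  exists xhat => t tN; have ce := xhatE t tN; split=> //.
  have [_ yE hE] := agree_ae (fun s st => gl s (ltn_trans st tN)).
  have gE : {ae P, forall o, input A B C x0 v w g t o =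
      F t *m output A B C x0 v w g t o + L t (past A B C x0 v w g t o)}.
    (* By uniqueness the inputs, outputs and pasts of [g] and of the linear optimum agree almost
       surely, so the linear formula holds along the trajectories of [g]. *)
    apply: filterS3 (gl t tN) yE hE => o -> -> ->; exact: linE.
  have := past_part_gain Q_pos Ru_pos S_pos x0_gauss v_gauss w_gauss indep
    g_opt tN (mL t tN) gE ce.
  by apply: filterS2 gE => o -> ->.
have gl t : (t < N)%N -> {ae P, forall o,
    input A B C x0 v w g t o = input A B C x0 v w lin t o}.
  elim/ltn_ind: t => t IH tN.
  have [xE yE hE] := agree_ae (fun s st => IH s st (ltn_trans st tN)).
  have [h mh ch] := state_cond_exp x0_gauss v_gauss w_gauss ladm lin_sq tN.
  have LE := past_part_gain Q_pos Ru_pos S_pos x0_gauss v_gauss w_gauss indep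
    F_opt tN (mL t tN) (aeW P (linE t)) ch.
  have [ceg inE] := xhatE t tN.
  have mpg := measurable_past A B C x0_gauss v_gauss w_gauss gadm (ltnW tN).
  have mpl := measurable_past A B C x0_gauss v_gauss w_gauss ladm (ltnW tN).
  have msg := measurable_state A B C x0_gauss v_gauss w_gauss gadm (ltnW tN).
  (* The estimator [h] of the linear optimum, evaluated on the past of [g], is a conditional
     expectation for [g] because the two laws have agreed so far; uniqueness identifies it with
     [xhat]. *)
  have xh i : {ae P, forall o, xhat t o i 0 = h (past A B C x0 v w g t o) i 0}.
    apply: (cond_exp_unique mpg (ceg i)).
    apply: (cond_exp_ae_eq (h := fun z => h z i 0) mpl mpg _ _ hE _ (ch i)).
    - by have /measurable_mxP/(_ i 0) := mh.
    - by have /measurable_mxP/(_ i 0) := msg.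
    - by apply: filterS xE => o ->.
  have {}xh : {ae P, forall o, xhat t o = h (past A B C x0 v w g t o)}.
    have : {ae P, forall o, forall i, xhat t o i 0 = h (past A B C x0 v w g t o) i 0}.
      exact: filter_forall.
    by apply: filterS => o Eo; apply/matrixP => i j; rewrite (ord1 j).
  have step : {ae P, forall o, input A B C x0 v w g t o =
      F t *m output A B C x0 v w lin t o + G t *m h (past A B C x0 v w lin t o)}.
    by apply: filterS3 inE xh (filterI yE hE) => o -> -> [-> ->].
  by apply: filterS2 step LE => o -> LEo; rewrite linE LEo.
(* Almost surely equal inputs give equal costs, so [g] inherits optimality. *)
split=> // g' g'adm; rewrite (agree_cost Q Ru S x0_gauss v_gauss w_gauss gadm ladm gl).
exact: F_opt.2.
Qed.
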